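(* For each perfect idyll $F$, the category $F\text{-}\mathbf{Mat}_\bullet$ of pointed $F$-matroids is proto-abelian (in the sense of André).
   Context: **Idylls.** A pointed monoid is a commutative multiplicative monoid $B=B'\sqcup\{0\}$ with $B'$ a submonoid and $0$ absorbing. Its ambient semiring is $B^+=\mathbb N[B]/\langle 0\rangle$ (finite formal sums of elements of $B$, with $0\in B$ identified with the empty sum). A band is a pointed monoid $B$ with a null set $N_B$, a proper ideal of $B^+$ with $0\in N_B$, such that for every $a\in B$ there is a unique $b\in B$, denoted $-a$, with $a+b\in N_B$. An idyll is a band $F$ with $F^\times=F\setminus\{0\}$. **$F$-matroids.** For a tuple $\mathbf x$, $|\mathbf x|$ is its set of entries and $\mathbf x_{\hat k}$ is $\mathbf x$ with the $k$th entry deleted. A Grassmann–Plücker function of rank $r$ on a finite set $E$ is a map $\mu:E^r\to F$ that is not identically zero ($E^0$ is a one-point set), is alternating ($\mu(\mathbf x^\sigma)=\mathrm{sign}(\sigma)\mu(\mathbf x)$ for $\sigma\in S_r$, and $\mu(\mathbf x)=0$ if $\mathbf x$ has a repeated entry), and satisfies $\sum_{k=0}^r(-1)^k\mu(\mathbf x_{\hat k})\mu(x_k,\mathbf y)\in N_F$ for all $\mathbf x=(x_0,\dots,x_r)\in E^{r+1}$, $\mathbf y\in E^{r-1}$. An $F$-matroid of rank $r$ on $E$ is a class $M=[\mu]$ of such functions up to scaling by $F^\times$. A pointed $F$-matroid is an $F$-matroid on a pointed finite set $E_M=\tilde E_M\sqcup\{*_M\}$ with $\mu(\mathbf x)=0$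 whenever some $x_i=*_M$. **Duals, vectors, perfect idylls.** For $M=[\mu]$ of rank $r$ on a totally ordered set $E$ with $n$ elements, $M^*=[\mu^*]$, where $\mu^*:E^{n-r}\to F$ is $0$ on tuples with repeated entries and otherwise $\mu^*(\mathbf x)=\mathrm{sign}(\mathbf x,\mathbf x')\mu(\mathbf x')$, with $|\mathbf x'|=E\setminus|\mathbf x|$ and $\mathrm{sign}$ the sign of the permutation of $E$ given by $(\mathbf x,\mathbf x')$. For $X,Y\in F^E$ write $X\perp Y$ if $\sum_eX_eY_e\in N_F$; $A^\perp$ is the set of vectors orthogonal to all of $A\subseteq F^E$. Circuits of $M$ are the vectors $aX_{\mathbf y}$, $a\in F^\times$, where $\mathbf y=(y_0,\dots,y_r)$ has distinct entries and some $\mu(\mathbf y_{\hat i})\neq0$, with $X_{\mathbf y}(y_k)=(-1)^k\mu(\mathbf y_{\hat k})$ and $X_{\mathbf y}(x)=0$ for $x\notin|\mathbf y|$. Let $\mathcal C_M$ be the set of circuits, $\mathcal C_M^*=\mathcal C_{M^*}$, $\mathcal V_M=(\mathcal C_M^* )^\perp$ (vectors), $\mathcal V_M^*=\mathcal C_M^\perp$ (covectors). $F$ is perfect if $\mathcal V_M\perp\mathcal V_M^*$ for all $F$-matroids $M$. For pointed $M$, $\mathcal V_M\subseteq F^{\tilde E_M}$ denotes the vectors of the $F$-matroid obtained by deleting $*_M$. **Category.** A submonomial matrix is a matrix over $F$ with at most one nonzero entry in each row and column. A morphism $f:M\to N$ of pointed $F$-matroids is a submonomial matrix with rows indexed by $\tilde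 E_N$, columns by $\tilde E_M$, such that $f\cdot\mathcal V_M\subseteq\mathcal V_N$. Composition is matrix multiplication. The matroid with ground set $\{*\}$ is the zero object. **Proto-abelian (André).** In a category with zero object, a kernel of $f:M\to N$ is a morphism $k:K\to M$ such that the square on $K\to M\to N$ and $K\to0\to N$ is Cartesian; a cokernel is defined dually. A strict monomorphism is a kernel of some morphism; a strict epimorphism is a cokernel of some morphism. A proto-abelian category is a pointed category having all kernels and cokernels such that: (PA1) any morphism with zero kernel (resp. zero cokernel) is a monomorphism (resp. epimorphism); (PA2) the pullback of a strict epimorphism along a strict monomorphism is a strict epimorphism, and the pushout of a strict monomorphism along a strict epimorphism is a strict monomorphism. *)

(* Defs.v *)
From HB Require Import structures.
From mathcomp Require Import all_boot all_fingroup.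
From mathcomp Require Import boolp classical_sets.

Set Implicit Arguments.
Unset Strict Implicit.
Unset Printing Implicit Defensive.

Local Open Scope classical_set_scope.

(* B = B' \sqcup {0}: pmul_neq0 and pone_neq0 say that the nonzero elements
   form a submonoid. *)
HB.mixin Record Monoid_isPointedMonoid B of monoid.Monoid B := {
  pzero : B;
  pmulC : forall a b : B, (a * b)%g = (b * a)%g;
  pmul0 : forall a : B, (pzero * a)%g = pzero;
  pone_neq0 : (1%g : B) != pzero;
  pmul_neq0 : forall a b : B, a != pzero -> b != pzero -> (a * b)%g != pzero
}.

#[short(type="pointedMonoidType")]
HB.structure Definition PointedMonoid :=
  {B of Monoid_isPointedMonoid B & monoid.Monoid B}.

Arguments pzero {s}.

(* A sequence s : seq B stands for the formal sum of its entries; two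
   sequences represent the same element of B^+ = N[B]/<0> iff they agree up
   to order and up to insertion or removal of entries 0. *)
Definition same_sum (B : pointedMonoidType) (s t : seq B) : bool :=
  perm_eq [seq a <- s | a != pzero] [seq a <- t | a != pzero].

Definition sum_mul (B : pointedMonoidType) (s t : seq B) : seq B :=
  [seq (a * b)%g | a <- s, b <- t].

(* The null set is a proper ideal of B^+: a predicate on formal sums that is
   compatible with same_sum. *)
HB.mixin Record PointedMonoid_isBand B of PointedMonoid B := {
  null : seq B -> Prop;
  opp : B -> B;
  null_same_sum : forall s t : seq B, same_sum s t -> null s -> null t;
  null0 : null [:: pzero];
  null_add : forall s t : seq B, null s -> null t -> null (s ++ t);
  null_mul : forall s t : seq B, null t -> null (sum_mul s t);
  null_proper : exists s : seq B, ~ null s;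
  null_opp : forall a b : B, null [:: a; b] <-> b = opp a
}.

#[short(type="bandType")]
HB.structure Definition Band :=
  {B of PointedMonoid_isBand B & PointedMonoid B}.

HB.mixin Record Band_isIdyll F of Band F := {
  idyll_unit : forall a : F, a != pzero -> exists b : F, (a * b)%g = 1%g
}.

#[short(type="idyllType")]
HB.structure Definition Idyll := {F of Band_isIdyll F & Band F}.

Definition sgn (F : bandType) (b : bool) : F := if b then opp 1%g else 1%g.
Arguments sgn {F} b.

Section Matroids.
Variables (F : idyllType) (E : finType).

Definition del_entry r (x : r.+1.-tuple E) (k : 'I_r.+1) : r.-tuple E :=
  [tuple tnth x (lift k i) | i < r].

Definition alternating r (mu : {ffun r.-tuple E -> F}) : Prop :=
  (forall (x : r.-tuple E) (s : 'S_r),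
     mu [tuple tnth x (s i) | i < r] = (sgn s * mu x)%g) /\
  (forall x : r.-tuple E, ~~ uniq x -> mu x = pzero).

(* For r = 0 there is no tuple y in E^(r-1), so the relation is void. *)
Definition GP_relations r : {ffun r.-tuple E -> F} -> Prop :=
  match r with
  | 0 => fun _ => True
  | r'.+1 => fun mu : {ffun r'.+1.-tuple E -> F} =>
      forall (x : r'.+2.-tuple E) (y : r'.-tuple E),
        null [seq (sgn (odd k) * mu (del_entry x k)
                     * mu [tuple of tnth x k :: y])%g | k : 'I_r'.+2 <- enum 'I_r'.+2]
  end.

Definition GP_function r (mu : {ffun r.-tuple E -> F}) : Prop :=
  [/\ exists x, mu x != pzero, alternating mu & GP_relations mu].

Definition scale_class r (mu : {ffun r.-tuple E -> F}) :
    set {ffun r.-tuple E -> F} :=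
  [set nu | exists2 a : F, a != pzero & nu = [ffun x => (a * mu x)%g]].

Definition is_matroid r (M : set {ffun r.-tuple E -> F}) : Prop :=
  exists2 mu, GP_function mu & M = scale_class mu.

(* E is totally ordered by its canonical enumeration, and the permutation
   given by an arrangement s of E sends the i-th element of E to the i-th
   entry of s.  (The default 1 is used only if s is not an arrangement.) *)
Definition perm_of_seq (s : seq E) : {perm E} :=
  insubd (1%g : {perm E}) [ffun e => nth e s (index e (enum E))].

(* When x has distinct entries and r <= #|E|, the sequence x' below has size
   r and insub succeeds.  As mu is alternating, the order chosen on the
   complement x' is immaterial. *)
Definition dual_fun r (mu : {ffun r.-tuple E -> F}) :
    {ffun (#|E| - r).-tuple E -> F} :=
  [ffun x : (#|E| - r).-tuple E =>
     let x' := [seq e <- enum E | e \notin x] in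
     if uniq x then
       (sgn (perm_of_seq (x ++ x'))
          * oapp mu pzero (insub x' : option (r.-tuple E)))%g
     else pzero].

Definition dual r (M : set {ffun r.-tuple E -> F}) :
    set {ffun (#|E| - r).-tuple E -> F} :=
  [set dual_fun mu | mu in M].

Definition orthogonal (X Y : {ffun E -> F}) : Prop :=
  null [seq (X e * Y e)%g | e <- enum E].

Definition orth_compl (A : set {ffun E -> F}) : set {ffun E -> F} :=
  [set X | forall Y, A Y -> orthogonal X Y].

Definition circuit_vec r (mu : {ffun r.-tuple E -> F}) (y : r.+1.-tuple E) :
    {ffun E -> F} :=
  [ffun e => if [pick k | tnth y k == e] is Some k
             then (sgn (odd k) * mu (del_entry y k))%g else pzero].

Definition circuits r (M : set {ffun r.-tuple E -> F}) : set {ffun E -> F} :=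
  [set X | exists mu (y : r.+1.-tuple E) (a : F),
     [/\ M mu, uniq y, exists i, mu (del_entry y i) != pzero, a != pzero
       & X = [ffun e => (a * circuit_vec mu y e)%g]]].

Definition vectors r (M : set {ffun r.-tuple E -> F}) : set {ffun E -> F} :=
  orth_compl (circuits (dual M)).

Definition covectors r (M : set {ffun r.-tuple E -> F}) : set {ffun E -> F} :=
  orth_compl (circuits M).

End Matroids.

Definition perfect (F : idyllType) : Prop :=
  forall (E : finType) (r : nat) (M : set {ffun r.-tuple E -> F}),
    is_matroid M ->
    forall X Y, vectors M X -> covectors M Y -> orthogonal X Y.

(* The pointed ground set is option tground, with base point None. *)
Record pointedMatroid (F : idyllType) := PointedMatroid {
  tground : finType;
  prank : nat;
  pclass : set {ffun prank.-tuple (option tground) -> F};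
  pclass_matroid : is_matroid pclass;
  pclass_pt : forall mu, pclass mu ->
    forall x : prank.-tuple (option tground), None \in x -> mu x = pzero
}.

Arguments pclass {F} p.

(* As the base point is a loop, deleting it does not change the rank and
   amounts to restricting the Grassmann-Pluecker functions. *)
Definition delete_pt (F : idyllType) (M : pointedMatroid F) :
    set {ffun (prank M).-tuple (tground M) -> F} :=
  [set [ffun x : (prank M).-tuple (tground M) => mu (map_tuple Some x)]
     | mu in pclass M].

Arguments delete_pt {F} M.

Definition pvectors (F : idyllType) (M : pointedMatroid F) :
    set {ffun tground M -> F} :=
  vectors (delete_pt M).

Arguments pvectors {F} M.

(* The value in F of the sum of a family with at most one nonzero term. *)
Definition fsum (F : idyllType) (I : finType) (t : I -> F) : F :=
  if [pick i | t i != pzero] is Some i then t i else pzero.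

Definition submonomial (F : idyllType) (I J : finType)
    (f : {ffun I * J -> F}) : Prop :=
  (forall i j j', f (i, j) != pzero -> f (i, j') != pzero -> j = j') /\
  (forall i i' j, f (i, j) != pzero -> f (i', j) != pzero -> i = i').

Definition sm_mul (F : idyllType) (I J K : finType)
    (g : {ffun I * J -> F}) (f : {ffun J * K -> F}) : {ffun I * K -> F} :=
  [ffun p => fsum (fun j => (g (p.1, j) * f (j, p.2))%g)].

Definition sm_act (F : idyllType) (I J : finType)
    (f : {ffun I * J -> F}) (X : {ffun J -> F}) : {ffun I -> F} :=
  [ffun i => fsum (fun j => (f (i, j) * X j)%g)].

Definition sm_one (F : idyllType) (I : finType) : {ffun I * I -> F} :=
  [ffun p => if p.1 == p.2 then 1%g else pzero].

Definition is_morphism (F : idyllType) (M N : pointedMatroid F)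
    (f : {ffun tground N * tground M -> F}) : Prop :=
  submonomial f /\ (forall X, pvectors M X -> pvectors N (sm_act f X)).

Section SubmonomialTheory.
Variable F : idyllType.
Implicit Types I J K L : finType.

Lemma pmulr0 (a : F) : (a * pzero)%g = pzero.
Proof. by rewrite pmulC pmul0. Qed.

Lemma pmul_eq0 (a b : F) :
  ((a * b)%g == pzero) = (a == pzero) || (b == pzero).
Proof.
case: (eqVneq a) => [->|a0]; first by rewrite pmul0 eqxx.
case: (eqVneq b) => [->|b0]; first by rewrite pmulr0 eqxx.
by apply/negbTE/pmul_neq0.
Qed.

Lemma eq_fsum I (t u : I -> F) : t =1 u -> fsum t = fsum u.
Proof.
by move=> tu; rewrite /fsum (eq_pick (Q := fun i => u i != pzero)) => [|i];
   [case: pickP | rewrite tu].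
Qed.

Lemma fsum_single I (t : I -> F) i0 :
  (forall i, t i != pzero -> i = i0) -> fsum t = t i0.
Proof.
move=> ti; rewrite /fsum; case: pickP => [i /ti -> //|t0].
by have /negbFE/eqP -> := t0 i0.
Qed.

Lemma fsum_zero I (t : I -> F) : (forall i, t i = pzero) -> fsum t = pzero.
Proof. by move=> t0; rewrite /fsum; case: pickP => // i _; rewrite t0. Qed.

Lemma fsum_neq0 I (t : I -> F) : fsum t != pzero -> exists i, t i != pzero.
Proof. by rewrite /fsum; case: pickP => [i ti _|_]; [exists i | rewrite eqxx]. Qed.

Lemma pmul_fsumr I (a : F) (t : I -> F) :
  (a * fsum t)%g = fsum (fun i => (a * t i)%g).
Proof.
have [->|a0] := eqVneq a pzero.
  by rewrite pmul0 fsum_zero // => i; rewrite pmul0.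
rewrite /fsum (eq_pick (P := fun i => (a * t i)%g != pzero)
  (Q := fun i => t i != pzero)).
  by case: pickP => // _; rewrite pmulr0.
by move=> i; rewrite /= pmul_eq0 (negbTE a0).
Qed.

Lemma pmul_fsuml I (a : F) (t : I -> F) :
  (fsum t * a)%g = fsum (fun i => (t i * a)%g).
Proof. by rewrite pmulC pmul_fsumr; apply: eq_fsum => i; rewrite pmulC. Qed.

Lemma exchange_fsum I J (t : I -> J -> F) :
  (forall i j i' j', t i j != pzero -> t i' j' != pzero -> i = i' /\ j = j') ->
  fsum (fun i => fsum (t i)) = fsum (fun j => fsum (t^~ j)).
Proof.
move=> tU; have [[i0 [j0 tij]]|t0] := pselect (exists i j, t i j != pzero).
  rewrite (fsum_single (i0 := i0)) => [|i /fsum_neq0[j]]; last first.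
    by case/tU/(_ tij).
  rewrite (fsum_single (i0 := j0)) => [|j]; last by case/tU/(_ tij).
  rewrite (fsum_single (i0 := j0)) => [|j /fsum_neq0[i]]; last first.
    by case/tU/(_ tij).
  by rewrite (fsum_single (i0 := i0)) // => i; case/tU/(_ tij).
have {}t0 i j : t i j = pzero.
  by apply/eqP/negPn/negP => tij; apply: t0; exists i, j.
by rewrite !fsum_zero // => i; rewrite fsum_zero.
Qed.

Lemma sm_mul_neq0 I J K (g : {ffun I * J -> F}) (f : {ffun J * K -> F}) i k :
  sm_mul g f (i, k) != pzero ->
  exists2 j, g (i, j) != pzero & f (j, k) != pzero.
Proof.
rewrite ffunE => /fsum_neq0[j] /=.
by rewrite pmul_eq0 negb_or => /andP[]; exists j.
Qed.

Lemma submonomial_mul I J K (g : {ffun I * J -> F}) (f : {ffun J * K -> F}) :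
  submonomial g -> submonomial f -> submonomial (sm_mul g f).
Proof.
move=> [gr gc] [fr fc]; split=> [i k k'|i i' k].
  move=> /sm_mul_neq0[j gij fjk] /sm_mul_neq0[j' gij' fjk'].
  by rewrite -(gr _ _ _ gij gij') in fjk'; apply: fr fjk fjk'.
move=> /sm_mul_neq0[j gij fjk] /sm_mul_neq0[j' gij' fjk'].
by rewrite -(fc _ _ _ fjk fjk') in gij'; apply: gc gij gij'.
Qed.

Lemma sm_act_mul I J K (g : {ffun I * J -> F}) (f : {ffun J * K -> F}) X :
  submonomial g -> submonomial f ->
  sm_act (sm_mul g f) X = sm_act g (sm_act f X).
Proof.
move=> [gr _] [fr _]; apply/ffunP => i; rewrite !ffunE.
transitivity (fsum (fun k => fsum (fun j => (g (i, j) * f (j, k) * X k)%g))).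
  by apply: eq_fsum => k; rewrite ffunE pmul_fsuml.
rewrite exchange_fsum.
  apply: eq_fsum => j; rewrite ffunE pmul_fsumr.
  by apply: eq_fsum => k; rewrite mulgA.
move=> k j k' j'; rewrite !pmul_eq0 !negb_or.
case/andP => /andP[gij fjk] _ /andP[/andP[gij' fjk'] _].
have jj' := gr _ _ _ gij gij'; split=> //.
by rewrite -jj' in fjk'; apply: fr fjk fjk'.
Qed.

Lemma sm_mulA I J K L (h : {ffun I * J -> F}) (g : {ffun J * K -> F})
    (f : {ffun K * L -> F}) :
  submonomial h -> submonomial g ->
  sm_mul h (sm_mul g f) = sm_mul (sm_mul h g) f.
Proof.
move=> hS gS; apply/ffunP => -[i l].
have := congr1 (fun X : {ffun I -> F} => X i)
  (sm_act_mul [ffun k => f (k, l)] hS gS).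
rewrite !ffunE /= => E.
transitivity (fsum (fun j => (h (i, j) *
    sm_act g [ffun k => f (k, l)] j)%g)).
  apply: eq_fsum => j; rewrite !ffunE /=; congr (_ * _)%g.
  by apply: eq_fsum => k; rewrite ffunE.
by rewrite -E; apply: eq_fsum => k; rewrite !ffunE.
Qed.

Lemma sm_mul1 I J (f : {ffun I * J -> F}) : sm_mul (sm_one F I) f = f.
Proof.
apply/ffunP => -[i j]; rewrite ffunE (fsum_single (i0 := i)) /= ?ffunE /=.
  by rewrite eqxx mul1g.
by move=> k; rewrite ffunE /=; case: (eqVneq i k) => // _; rewrite pmul0 eqxx.
Qed.

Lemma sm_mulr1 I J (f : {ffun I * J -> F}) : sm_mul f (sm_one F J) = f.
Proof.
apply/ffunP => -[i j]; rewrite ffunE (fsum_single (i0 := j)) /= ?ffunE /=.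
  by rewrite eqxx mulg1.
by move=> k; rewrite ffunE /=; case: (eqVneq k j) => // _; rewrite pmulr0 eqxx.
Qed.

Lemma sm_act1 I (X : {ffun I -> F}) : sm_act (sm_one F I) X = X.
Proof.
apply/ffunP => i; rewrite ffunE (fsum_single (i0 := i)) /= ?ffunE /=.
  by rewrite eqxx mul1g.
by move=> k; rewrite ffunE /=; case: (eqVneq i k) => // _; rewrite pmul0 eqxx.
Qed.

Lemma is_morphism_one (M : pointedMatroid F) :
  is_morphism (M := M) (N := M) (sm_one F (tground M)).
Proof.
split=> [|X VX]; last by rewrite sm_act1.
split=> [i j j'|i i' j]; rewrite !ffunE /=.
  case: (eqVneq i j) => [<- _|_]; last by rewrite eqxx.
  by case: (eqVneq i j') => // _; rewrite eqxx.
case: (eqVneq i j) => [-> _|_]; last by rewrite eqxx.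
by case: (eqVneq i' j) => // _; rewrite eqxx.
Qed.

Lemma is_morphism_mul (M N P : pointedMatroid F) g f :
  is_morphism (M := N) (N := P) g -> is_morphism (M := M) (N := N) f ->
  is_morphism (M := M) (N := P) (sm_mul g f).
Proof.
move=> [gS gV] [fS fV]; split; first exact: submonomial_mul.
by move=> X VX; rewrite sm_act_mul //; apply/gV/fV.
Qed.

End SubmonomialTheory.

Record category := Category {
  ob :> Type;
  hom : ob -> ob -> Type;
  idc : forall A, hom A A;
  comp : forall A B C, hom B C -> hom A B -> hom A C;
  compA : forall A B C D (h : hom C D) (g : hom B C) (f : hom A B),
    comp h (comp g f) = comp (comp h g) f;
  comp1f : forall A B (f : hom A B), comp (idc B) f = f;
  compf1 : forall A B (f : hom A B), comp f (idc A) = f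
}.

Section CategoryNotions.
Variable C : category.

Definition is_zero_object (Z : C) : Prop :=
  forall A : C, (exists! f : hom A Z, True) /\ (exists! f : hom Z A, True).

Definition is_mono (A B : C) (f : hom A B) : Prop :=
  forall (T : C) (u v : hom T A), comp f u = comp f v -> u = v.

Definition is_epi (A B : C) (f : hom A B) : Prop :=
  forall (T : C) (u v : hom B T), comp u f = comp v f -> u = v.

Definition is_pullback (P A B D : C) (p : hom P A) (q : hom P B)
    (f : hom A D) (g : hom B D) : Prop :=
  comp f p = comp g q /\
  forall (T : C) (u : hom T A) (v : hom T B), comp f u = comp g v ->
    exists! h : hom T P, comp p h = u /\ comp q h = v.

Definition is_pushout (D A B P : C) (f : hom D A) (g : hom D B)
    (p : hom A P) (q : hom B P) : Prop :=
  comp p f = comp q g /\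
  forall (T : C) (u : hom A T) (v : hom B T), comp u f = comp v g ->
    exists! h : hom P T, comp h p = u /\ comp h q = v.

Definition is_kernel (M N K : C) (f : hom M N) (k : hom K M) : Prop :=
  exists (Z : C) (a : hom K Z) (b : hom Z N),
    is_zero_object Z /\ is_pullback k a f b.

Definition is_cokernel (M N Q : C) (f : hom M N) (c : hom N Q) : Prop :=
  exists (Z : C) (a : hom M Z) (b : hom Z Q),
    is_zero_object Z /\ is_pushout f a c b.

Definition strict_mono (K M : C) (k : hom K M) : Prop :=
  exists (N : C) (f : hom M N), is_kernel f k.

Definition strict_epi (N Q : C) (c : hom N Q) : Prop :=
  exists (M : C) (f : hom M N), is_cokernel f c.

Definition PA1 : Prop :=
  (forall (M N K : C) (f : hom M N) (k : hom K M),
     is_kernel f k -> is_zero_object K -> is_mono f) /\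
  (forall (M N Q : C) (f : hom M N) (c : hom N Q),
     is_cokernel f c -> is_zero_object Q -> is_epi f).

(* Only Cartesian and co-Cartesian squares are quantified over: the pullback
   of g along f = ker h always exists, as the kernel of h g, and dually. *)
Definition PA2 : Prop :=
  (forall (P A B D : C) (p : hom P A) (q : hom P B)
          (f : hom A D) (g : hom B D),
     is_pullback p q f g -> strict_mono f -> strict_epi g -> strict_epi p) /\
  (forall (D A B P : C) (f : hom D A) (g : hom D B)
          (p : hom A P) (q : hom B P),
     is_pushout f g p q -> strict_mono g -> strict_epi f -> strict_mono p).

Definition proto_abelian : Prop :=
  [/\ exists Z : C, is_zero_object Z,
      forall (M N : C) (f : hom M N), exists (K : C) (k : hom K M),
        is_kernel f k,
      forall (M N : C) (f : hom M N), exists (Q : C) (c : hom N Q),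
        is_cokernel f c,
      PA1 & PA2].

End CategoryNotions.

Record matMor (F : idyllType) (M N : pointedMatroid F) := MatMor {
  mor_mx :> {ffun tground N * tground M -> F};
  mor_mxP : is_morphism mor_mx
}.

Section MatCategory.
Variable F : idyllType.

Lemma matMor_inj (M N : pointedMatroid F) (f g : matMor M N) :
  mor_mx f = mor_mx g -> f = g.
Proof.
case: f g => [f fP] [g gP] /= fg; rewrite {f}fg in fP *.
by rewrite (Prop_irrelevance fP gP).
Qed.

Definition mat_id (M : pointedMatroid F) : matMor M M :=
  MatMor (is_morphism_one M).

Definition mat_comp (M N P : pointedMatroid F)
    (g : matMor N P) (f : matMor M N) : matMor M P :=
  MatMor (is_morphism_mul (mor_mxP g) (mor_mxP f)).

Lemma mat_compA (M N P Q : pointedMatroid F)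
    (h : matMor P Q) (g : matMor N P) (f : matMor M N) :
  mat_comp h (mat_comp g f) = mat_comp (mat_comp h g) f.
Proof.
by apply/matMor_inj/sm_mulA; [case: (mor_mxP h) | case: (mor_mxP g)].
Qed.

Lemma mat_comp1f (M N : pointedMatroid F) (f : matMor M N) :
  mat_comp (mat_id N) f = f.
Proof. exact/matMor_inj/sm_mul1. Qed.

Lemma mat_compf1 (M N : pointedMatroid F) (f : matMor M N) :
  mat_comp f (mat_id M) = f.
Proof. exact/matMor_inj/sm_mulr1. Qed.

Definition FMat : category := Category mat_compA mat_comp1f mat_compf1.

End MatCategory.

(* Main.v *)
From HB Require Import structures.
From mathcomp Require Import all_boot all_fingroup.
From mathcomp Require Import boolp classical_sets.
Require Import Defs.

(** For a perfect idyll the theory is self-dual: vectors and covectors are each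
other's orthogonal complements (vecP), so that a submonomial matrix is a
morphism if and only if its transpose preserves covectors (mx_covect).
Transposition thus exchanges kernels with cokernels, and every statement needs
a proof on one side only.

Kernels.  A morphism u satisfies f u = 0 if and only if its rows are supported
on the set K of zero columns of f, so that the kernel of f : M -> N is the
restriction M|K, provided that the vectors of M|K are exactly the vectors of M
supported on K.  To see this, let b be the elements off K of a basis of M with
as few of them as possible; M|K is given by the Grassmann-Pluecker function
x |-> mu(x, b).  By the minimality of b, circuits of M|K are circuits of M
(cvec_minor_ext), and cocircuits of M|K are restrictions of cocircuits of M.
Conversely, the restriction Y|K of a cocircuit Y of M is orthogonal to the
circuits of M|K, hence a covector of M|K, and perfection makes it orthogonal to
all the vectors of M|K (restriction_embedding).  Dually, cokernels are
contractions, built in the same way from a basis with as many elements off K as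
possible; deletion and contraction of matroids are only used in this form, so
that duals of matroids intervene merely through the identification of their
circuits with the vectors e |-> mu(e, w), which is a computation of signs
(cvec_dual).

Axiom (PA1).  If the kernel of f is zero, then f has no zero column, hence a
left inverse among submonomial matrices, and is a monomorphism.

Axiom (PA2).  Strict monomorphisms are, up to isomorphism, the inclusions of
restrictions, and strict epimorphisms the projections on contractions.  The
pullback of B -> B/I along (B/I)|J -> B/I is the restriction of B to the union
of I and J, and its projection to (B/I)|J is a strict epimorphism if
restriction and contraction commute: an element Z of F^J that pulls back to a
covector of that restriction has to be a covector of (B/I)|J.  This is tested
on circuits of (B/I)|J; they are circuits of B/I, which lift to circuits of B,
and those are supported on the union of I and J (pullback_strict_epi). *)

Set Implicit Arguments.
Unset Strict Implicit.
Unset Printing Implicit Defensive.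

Local Open Scope classical_set_scope.

(** * Null sums and signs *)

Section NullSums.
Variable F : idyllType.
Implicit Types (a b c : F) (s t : seq F).

Lemma null_perm s t : perm_eq s t -> null s -> null t.
Proof. by move=> st; apply/null_same_sum/perm_filter. Qed.

Lemma null_filter s : null [seq a <- s | a != pzero] <-> null s.
Proof.
by split; apply: null_same_sum; rewrite /same_sum filter_id perm_refl.
Qed.

Lemma null_nil : null ([::] : seq F).
Proof. by have := null0 (s := F); rewrite -null_filter /= eqxx. Qed.

Lemma null_all0 s : {in s, forall a, a = pzero} -> null s.
Proof.
move=> s0; apply/null_filter; rewrite (eq_in_filter (a2 := pred0)).
  by rewrite filter_pred0; apply: null_nil.
by move=> a /s0 ->; rewrite eqxx.
Qed.

Lemma null_scale a s : null s -> null [seq (a * b)%g | b <- s].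
Proof. by move/(null_mul [:: a]); rewrite /sum_mul /= cats0. Qed.

Lemma opp_mul a : opp a = (opp 1 * a)%g.
Proof.
apply/esym/null_opp; have := @null_scale a [:: 1%g; opp 1%g].
by rewrite /= mulg1 (pmulC a); apply; apply/null_opp.
Qed.

Lemma oppK : involutive (@opp F).
Proof.
move=> a; apply/esym/null_opp; apply: (@null_perm [:: a; opp a]).
  by rewrite (perm_catC [:: a] [:: opp a]).
exact/null_opp.
Qed.

Lemma sgnD (x y : bool) : (sgn (x (+) y) : F) = (sgn x * sgn y)%g.
Proof.
by case: x y => [] []; rewrite /sgn /= ?mul1g ?mulg1 // -opp_mul oppK.
Qed.

Lemma sgn_sq (x : bool) : (sgn x * sgn x : F)%g = 1%g.
Proof. by rewrite -sgnD addbb. Qed.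

Lemma pmul_neq0P a b : (a * b)%g != pzero -> a != pzero /\ b != pzero.
Proof. by rewrite pmul_eq0 negb_or => /andP. Qed.

Lemma sgn_neq0 (x : bool) : (sgn x : F) != pzero.
Proof.
by have /pmul_neq0P[] : (sgn x * sgn x : F)%g != pzero
  by rewrite sgn_sq pone_neq0.
Qed.

Lemma pmulCA a b c : (a * (b * c))%g = (b * (a * c))%g.
Proof. by rewrite !mulgA (pmulC a). Qed.

Lemma pinv_exists a : exists b, a != pzero -> (a * b)%g = 1%g.
Proof.
by have [->|/idyll_unit[b ab]] := eqVneq a pzero; [exists 1%g | exists b].
Qed.

Definition pinv a : F := projT1 (cid (pinv_exists a)).

Lemma pmulV a : a != pzero -> (a * pinv a)%g = 1%g.
Proof. by rewrite /pinv; case: cid. Qed.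

Lemma pinv_neq0 a : a != pzero -> pinv a != pzero.
Proof.
move=> a0; have /pmul_neq0P[//] : (a * pinv a)%g != pzero.
by rewrite pmulV // pone_neq0.
Qed.

Lemma null_scaleE a s : a != pzero ->
  null [seq (a * b)%g | b <- s] <-> null s.
Proof.
move=> a0; split=> [/(null_scale (pinv a))|]; last exact: null_scale.
rewrite -map_comp (eq_map (g := id)) ?map_id // => b /=.
by rewrite mulgA (pmulC (pinv a)) pmulV // mul1g.
Qed.

(** Only the nonzero terms of a family matter, so that the index sets may be
   changed as long as those terms are kept. *)
Lemma null_support (I : eqType) (f : I -> F) (r q : seq I) :
  uniq r -> uniq q -> (forall i, f i != pzero -> (i \in r) = (i \in q)) ->
  null [seq f i | i <- r] <-> null [seq f i | i <- q].
Proof.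
move=> Ur Uq rq; rewrite -null_filter -[X in _ <-> X]null_filter !filter_map.
have /(perm_map f) P : perm_eq [seq i <- r | f i != pzero]
    [seq i <- q | f i != pzero].
  apply: uniq_perm; rewrite ?filter_uniq // => i; rewrite !mem_filter.
  by case: eqVneq => //= f0; apply: rq.
by split; apply: null_perm; rewrite // perm_sym.
Qed.

End NullSums.

(** * Orthogonality and transposition *)

Section Orthogonality.
Variable F : idyllType.
Implicit Types I J K : finType.

Lemma orthogonalC I (X Y : {ffun I -> F}) : orthogonal X Y <-> orthogonal Y X.
Proof.
by rewrite /orthogonal; under eq_map do rewrite pmulC.
Qed.

Lemma orthogonal_scale I (a : F) (X Y : {ffun I -> F}) : a != pzero ->
  orthogonal X [ffun e => (a * Y e)%g] <-> orthogonal X Y.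
Proof.
move=> a0; rewrite /orthogonal.
have -> : [seq (X e * [ffun e => (a * Y e)%g] e)%g | e <- enum I] =
    [seq (a * b)%g | b <- [seq (X e * Y e)%g | e <- enum I]].
  rewrite -map_comp; apply: eq_map => e /=.
  by rewrite ffunE mulgA (pmulC (X e)) mulgA.
exact: null_scaleE.
Qed.

Definition sm_tr I J (f : {ffun I * J -> F}) : {ffun J * I -> F} :=
  [ffun p => f (p.2, p.1)].

Lemma sm_trE I J (f : {ffun I * J -> F}) i j : sm_tr f (j, i) = f (i, j).
Proof. by rewrite ffunE. Qed.

Lemma sm_trK I J (f : {ffun I * J -> F}) : sm_tr (sm_tr f) = f.
Proof. by apply/ffunP => -[i j]; rewrite !ffunE. Qed.

Lemma submonomial_tr I J (f : {ffun I * J -> F}) :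
  submonomial f -> submonomial (sm_tr f).
Proof. by case=> fr fc; split=> ? ? ?; rewrite !sm_trE; [apply: fc|apply: fr]. Qed.

Lemma sm_tr_mul I J K (g : {ffun I * J -> F}) (f : {ffun J * K -> F}) :
  sm_tr (sm_mul g f) = sm_mul (sm_tr f) (sm_tr g).
Proof.
by apply/ffunP => -[k i]; rewrite !ffunE /=; apply: eq_fsum => j;
   rewrite !ffunE pmulC.
Qed.

Lemma sm_tr_one I : sm_tr (sm_one F I) = sm_one F I.
Proof. by apply/ffunP => -[i j]; rewrite !ffunE eq_sym. Qed.

(** Both sums have the same nonzero terms, one for each nonzero entry of the
   matrix t. *)
Lemma null_fsum_exchange I J (t : I -> J -> F) :
  (forall i j j', t i j != pzero -> t i j' != pzero -> j = j') ->
  (forall i i' j, t i j != pzero -> t i' j != pzero -> i = i') ->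
  null [seq fsum (t i) | i <- enum I] <-> null [seq fsum (t^~ j) | j <- enum J].
Proof.
move=> tr tc; pose s := [seq p <- enum {: I * J} | t p.1 p.2 != pzero].
have mem_s p : (p \in s) = (t p.1 p.2 != pzero).
  by rewrite mem_filter mem_enum andbT.
have Us : uniq s by rewrite filter_uniq ?enum_uniq.
have Ur : null [seq fsum (t p.1) | p <- s] <-> null [seq fsum (t i) | i <- enum I].
  rewrite (map_comp (fun i => fsum (t i)) fst); apply: null_support.
  - rewrite map_inj_in_uniq // => -[i j] [i' j']; rewrite !mem_s /=.
    by move=> ti ti' ii'; rewrite -ii' in ti' *; rewrite (tr _ _ _ ti ti').
  - exact: enum_uniq.
  move=> i /fsum_neq0[j tij]; rewrite mem_enum.
  by apply/mapP; exists (i, j); rewrite ?mem_s.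
have Uc : null [seq fsum (t^~ p.2) | p <- s] <-> null [seq fsum (t^~ j) | j <- enum J].
  rewrite (map_comp (fun j => fsum (t^~ j)) snd); apply: null_support.
  - rewrite map_inj_in_uniq // => -[i j] [i' j']; rewrite !mem_s /=.
    by move=> ti ti' jj'; rewrite -jj' in ti' *; rewrite (tc _ _ _ ti ti').
  - exact: enum_uniq.
  move=> j /fsum_neq0[i tij]; rewrite mem_enum.
  by apply/mapP; exists (i, j); rewrite ?mem_s.
rewrite -Ur -Uc; suff -> : [seq fsum (t p.1) | p <- s] = [seq fsum (t^~ p.2) | p <- s] by [].
apply/eq_in_map => -[i j]; rewrite mem_s /= => tij.
rewrite (fsum_single (i0 := j)) => [|j' tij']; last exact: tr tij' tij.
by rewrite (fsum_single (i0 := i)) // => i' ti'j; apply: tc ti'j tij.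
Qed.

Lemma orthogonal_act I J (f : {ffun I * J -> F}) (X : {ffun J -> F}) Y :
  submonomial f -> orthogonal (sm_act f X) Y <-> orthogonal X (sm_act (sm_tr f) Y).
Proof.
move=> [fr fc]; pose t i j := (f (i, j) * X j * Y i)%g.
have tP i j : t i j != pzero -> f (i, j) != pzero.
  by move=> /pmul_neq0P[/pmul_neq0P[]].
have := @null_fsum_exchange _ _ t.
have -> : [seq fsum (t i) | i <- enum I] = [seq (sm_act f X i * Y i)%g | i <- enum I].
  by apply: eq_map => i; rewrite ffunE pmul_fsuml.
have -> : [seq fsum (t^~ j) | j <- enum J] =
    [seq (X j * sm_act (sm_tr f) Y j)%g | j <- enum J].
  apply: eq_map => j; rewrite ffunE pmul_fsumr; apply: eq_fsum => i.
  by rewrite sm_trE mulgA (pmulC (X j)).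
apply=> [i j j' /tP fij /tP fij'|i i' j /tP fij /tP fij']; first exact: fr fij fij'.
exact: fc fij fij'.
Qed.

Lemma sm_act_single I J (f : {ffun I * J -> F}) X i j : submonomial f ->
  f (i, j) != pzero -> sm_act f X i = (f (i, j) * X j)%g.
Proof.
move=> [fr _] fij; rewrite ffunE (fsum_single (i0 := j)) // => j' /pmul_neq0P[f' _].
exact: fr f' fij.
Qed.

(** The matrix that extends vectors along an injection by 0; its transpose
   restricts them. *)
Definition incl_mx I J (h : J -> I) : {ffun I * J -> F} :=
  [ffun p => if p.1 == h p.2 then 1%g else pzero].

Lemma incl_mxE I J (h : J -> I) i j : incl_mx h (i, j) != pzero -> i = h j.
Proof. by rewrite ffunE /=; case: (eqVneq i (h j)); rewrite // eqxx. Qed.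

Lemma incl_mx1 I J (h : J -> I) j : incl_mx h (h j, j) = 1%g.
Proof. by rewrite ffunE eqxx. Qed.

Lemma submonomial_incl I J (h : J -> I) :
  injective h -> submonomial (incl_mx h).
Proof.
move=> hI; split=> [i j j' /incl_mxE -> /incl_mxE /hI //|i i' j].
by move=> /incl_mxE -> /incl_mxE.
Qed.

Lemma incl_act I J (h : J -> I) X j : injective h ->
  sm_act (incl_mx h) X (h j) = X j.
Proof.
move=> hI; rewrite (sm_act_single _ (j := j)) ?incl_mx1 ?mul1g ?pone_neq0 //.
exact: submonomial_incl.
Qed.

Lemma incl_act0 I J (h : J -> I) X i :
  (forall j, i <> h j) -> sm_act (incl_mx h) X i = pzero.
Proof.
move=> hi; rewrite ffunE fsum_zero // => j.
by rewrite ffunE /=; case: eqVneq => [/hi//|_]; rewrite pmul0.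
Qed.

Lemma incl_tr_act I J (h : J -> I) (X : {ffun I -> F}) :
  injective h -> sm_act (sm_tr (incl_mx h)) X = [ffun j => X (h j)].
Proof.
move=> hI; apply/ffunP => j.
rewrite (sm_act_single _ (j := h j)) ?sm_trE ?incl_mx1 ?mul1g ?ffunE ?pone_neq0 //.
exact/submonomial_tr/submonomial_incl.
Qed.

Lemma incl_act_tr I J (h : J -> I) (X : {ffun I -> F}) : injective h ->
  (forall i, X i != pzero -> exists j, i = h j) ->
  sm_act (incl_mx h) [ffun j => X (h j)] = X.
Proof.
move=> hI hX; apply/ffunP => i; have [[j ->]|nj] := pselect (exists j, i = h j).
  by rewrite incl_act // ffunE.
rewrite incl_act0 => [|j ij]; last by apply: nj; exists j.
by apply/esym/eqP/negPn/negP => /hX.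
Qed.

End Orthogonality.

(** * Alternating functions on sequences *)

Section Alternating.
Variable I : eqType.
Implicit Types (a c : I) (u v s t : seq I).

(** Adjacent transpositions generate all permutations. *)
Lemma perm_invariant (T : Type) (g : seq I -> T) s t :
  (forall u a c v, g (u ++ a :: c :: v) = g (u ++ c :: a :: v)) ->
  perm_eq s t -> g s = g t.
Proof.
move=> gS; have gM u a p v : g (p ++ u ++ a :: v) = g (p ++ a :: u ++ v).
  elim: u p => //= c u IH p; rewrite -cat_rcons IH cat_rcons; exact: gS.
suff gP p : perm_eq s t -> g (p ++ s) = g (p ++ t) by apply: (gP [::]).
elim: s p t => [|a s IH] p t; first by rewrite perm_sym => /perm_nilP ->.
move=> st; have at_ : a \in t by rewrite -(perm_mem st) inE eqxx.
case/splitPr: at_ st => t1 t2 st; rewrite gM -!cat_rcons; apply: IH.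
rewrite -(perm_cons a); apply: perm_trans st _.
by rewrite -(cat1s a t2) perm_catCA.
Qed.

(** Two alternating functions depend on the order of their arguments by the
   same sign, so that their product does not depend on it. *)
Lemma alternating_mul_perm (F : idyllType) (m n : seq I -> F) s t :
  (forall u a c v, perm_eq s (u ++ a :: c :: v) ->
     m (u ++ a :: c :: v) = (opp 1 * m (u ++ c :: a :: v))%g) ->
  (forall u a c v, perm_eq s (u ++ a :: c :: v) ->
     n (u ++ a :: c :: v) = (opp 1 * n (u ++ c :: a :: v))%g) ->
  perm_eq s t -> (m s * n s)%g = (m t * n t)%g.
Proof.
move=> mS nS st.
pose g u := if perm_eq s u then (m u * n u)%g else pzero.
have <- : g s = (m s * n s)%g by rewrite /g perm_refl.
have <- : g t = (m t * n t)%g by rewrite /g st.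
apply: perm_invariant st => u a c v; rewrite /g.
have P : perm_eq (u ++ a :: c :: v) (u ++ c :: a :: v).
  by rewrite perm_cat2l (perm_catCA [:: a] [:: c]).
rewrite -(permPr P); case: ifP => // U; rewrite mS // nS //.
rewrite -!mulgA (mulgA (m _)) (pmulC (m _)) -mulgA mulgA.
by rewrite -[opp 1%g]/(sgn true) sgn_sq mul1g.
Qed.

End Alternating.

(** * Grassmann-Pluecker functions on sequences *)

Section SeqGP.
Variables (F : idyllType) (E : finType).
Implicit Types (m : seq E -> F) (x y u v w b : seq E) (e : E).

Definition del_nth k x := take k x ++ drop k.+1 x.

Lemma del_nth_cat k x b : k < size x -> del_nth k (x ++ b) = del_nth k x ++ b.
Proof.
move=> kx; rewrite /del_nth -catA take_cat drop_cat kx; congr (_ ++ _).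
case: ltnP => // xk; rewrite [X in X ++ b]drop_oversize //.
by rewrite (_ : _ - _ = 0) ?drop0 //; apply/eqP; rewrite subn_eq0.
Qed.

Lemma del_nth_map (E' : finType) (h : E' -> E) k (x : seq E') :
  del_nth k (map h x) = map h (take k x ++ drop k.+1 x).
Proof. by rewrite /del_nth map_cat map_take map_drop. Qed.

(** Grassmann-Pluecker functions of rank r, extended by 0 to the sequences of
   any other size, so that concatenation needs no cast; being alternating is
   expressed by adjacent transpositions.  Being not identically zero, the one
   clause that minors may break, is kept apart. *)
Record seq_GP r m : Prop := SeqGP {
  gp_size : forall x, m x != pzero -> size x = r;
  gp_uniq : forall x, m x != pzero -> uniq x;
  gp_swap : forall u a c v,
    m (u ++ a :: c :: v) = (opp 1 * m (u ++ c :: a :: v))%g;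
  gp_rel : forall e x y, null [seq (sgn (odd k) * m (del_nth k x)
                                    * m (nth e x k :: y))%g | k <- iota 0 (size x)]
}.

Definition cvec m y : {ffun E -> F} :=
  [ffun e => if e \in y then (sgn (odd (index e y)) * m (rem e y))%g else pzero].

Definition covec m w : {ffun E -> F} := [ffun e => m (e :: w)].

(** This is the Grassmann-Pluecker relation for y and w. *)
Lemma cvec_covec_orth r m y w : seq_GP r m -> uniq y ->
  orthogonal (cvec m y) (covec m w).
Proof.
move=> mGP Uy; case: y Uy => [|e y'] Uy.
  by apply: null_all0 => _ /mapP[e _ ->]; rewrite ffunE in_nil pmul0.
set y := e :: y' in Uy *.
apply: (proj1 (@null_support _ _ (fun e => cvec m y e * covec m w e)%g y (enum E)
  Uy (enum_uniq E) _)).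
  move=> e'; rewrite mem_enum inE ffunE => /pmul_neq0P[].
  by case: ifP => // _; rewrite eqxx.
have := gp_rel mGP e y w; congr (null _).
rewrite -[X in _ = map _ X](mkseq_nth e) /mkseq -map_comp.
apply/eq_in_map => k; rewrite mem_iota add0n /= => ky.
by rewrite !ffunE mem_nth // index_uniq // remE index_uniq.
Qed.

Lemma gp_neq0_perm r m x y : seq_GP r m -> perm_eq x y ->
  m x != pzero -> m y != pzero.
Proof.
move=> mGP xy; rewrite (@perm_invariant _ _ (fun x => m x != pzero) x y) //.
move=> u a c v; rewrite (gp_swap mGP) pmul_eq0 -[opp 1%g]/(sgn true).
by rewrite (negbTE (sgn_neq0 _ _)).
Qed.

Lemma seq_GP_scale r m a : seq_GP r m -> seq_GP r (fun x => a * m x)%g.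
Proof.
move=> mGP; split=> [x|x|u c d v|e x y].
- by move=> /pmul_neq0P[_ /(gp_size mGP)].
- by move=> /pmul_neq0P[_ /(gp_uniq mGP)].
- by rewrite (gp_swap mGP) !mulgA (pmulC a).
have /(null_scale a) /(null_scale a) := gp_rel mGP e x y.
rewrite -!map_comp; congr (null _); apply: eq_map => k /=.
by rewrite [RHS]pmulCA; congr (_ * _)%g; rewrite !mulgA (pmulC a).
Qed.

Lemma cvec_scale m a y :
  cvec (fun x => a * m x)%g y = [ffun e => (a * cvec m y e)%g].
Proof.
apply/ffunP => e; rewrite !ffunE; case: ifP; rewrite ?pmulr0 // => _.
by rewrite !mulgA (pmulC a).
Qed.

Lemma covec_scale m a w :
  covec (fun x => a * m x)%g w = [ffun e => (a * covec m w e)%g].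
Proof. by apply/ffunP => e; rewrite !ffunE. Qed.

End SeqGP.

(** * Minors *)

Section Minors.
Variables (F : idyllType) (E E' : finType) (h : E' -> E).
Hypothesis hI : injective h.
Implicit Types (m : seq E -> F).

(** With h the inclusion of E' and b a tuple off E', this is the minor of m
   on E' obtained by contracting b and deleting the other elements.  Placing
   b last makes the sign of every correspondence below trivial. *)
Definition minor m (b : seq E) : seq E' -> F := fun x => m (map h x ++ b).

Lemma seq_GP_minor r m b : seq_GP (r + size b) m -> seq_GP r (minor m b).
Proof.
move=> mGP; split.
- by move=> x /(gp_size mGP)/eqP; rewrite size_cat size_map eqn_add2r => /eqP.
- by move=> x /(gp_uniq mGP); rewrite cat_uniq map_inj_uniq // => /andP[].
- by move=> u a c v; rewrite /minor !map_cat /= -!catA /= (gp_swap mGP).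
move=> e x y; have := gp_rel mGP (h e) (map h x ++ b) (map h y ++ b).
rewrite -null_filter -[X in _ -> X]null_filter; congr (null _).
rewrite size_cat iotaD map_cat filter_cat size_map.
(* moving an entry of b into the second factor, which contains b, repeats it *)
rewrite [X in _ ++ X](_ : _ = [::]) ?cats0.
  congr filter; apply/eq_in_map => k; rewrite mem_iota add0n => /= kx.
  rewrite nth_cat size_map kx (nth_map e) //; congr (_ * m _ * _)%g.
  by rewrite del_nth_cat ?size_map // del_nth_map.
apply/eqP; rewrite -(negbK (_ == _)) -has_filter has_map; apply/hasPn => k.
rewrite mem_iota /= => /andP[xk kb]; apply/negP => /pmul_neq0P[_ /(gp_uniq mGP)].
rewrite /= nth_cat size_map ltnNge xk /= mem_cat mem_nth ?orbT //.
by rewrite ltn_subLR.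
Qed.

Lemma covec_minor m b w :
  covec (minor m b) w = [ffun j => covec m (map h w ++ b) (h j)].
Proof. by apply/ffunP => j; rewrite !ffunE. Qed.

Lemma cvec_minor m b y : (forall j, h j \notin b) ->
  cvec (minor m b) y = [ffun j => cvec m (map h y ++ b) (h j)].
Proof.
move=> hb; apply/ffunP => j; rewrite !ffunE mem_cat (negbTE (hb j)) orbF.
rewrite mem_map //; case: ifP => // jy.
rewrite [rem (h j) _]remE index_cat map_f // index_map // -/(del_nth (index j y) _).
by rewrite del_nth_cat ?size_map ?index_mem // del_nth_map // /minor remE.
Qed.

Let off := [pred e | e \notin codom h].

Lemma codomhP e : reflect (exists j, e = h j) (e \in codom h).
Proof. by apply: (iffP (codomP)). Qed.

(** Removing an entry of b from the tuple of the circuit would leave a basis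
   with fewer elements off E' than b, so that the circuit vanishes on b. *)
Lemma cvec_minor_ext m b y : all off b ->
  (forall x, m x != pzero -> size b <= count off x) ->
  cvec m (map h y ++ b) = sm_act (incl_mx F h) (cvec (minor m b) y).
Proof.
move=> /allP offb minb; rewrite cvec_minor => [|j]; last first.
  by apply/negP => /offb /=; rewrite codom_f.
rewrite incl_act_tr // => e; rewrite ffunE; case: ifP; last by rewrite eqxx.
move=> ey /pmul_neq0P[_ mrem]; apply/codomhP/negPn/negP => offe.
have eb : e \in b.
  by move: ey offe; rewrite mem_cat => /orP[/mapP[j _ ->]|//]; rewrite codom_f.
have /minb := mrem; rewrite leqNgt => /negP[]; rewrite count_rem /= ey offe /=.
rewrite count_cat (_ : count off (map h y) = 0) ?add0n; last first.
  by apply/eqP; rewrite -leqn0 leqNgt -has_count has_map; apply/hasPn => j _ /=;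
     rewrite codom_f.
move/allP: offb; rewrite all_count => /eqP ->.
by case: b eb {minb mrem ey} => //= a b' _; rewrite subn1 ltnSn.
Qed.

(** At an element off E' the cocircuit takes its value on a tuple with more
   elements off E' than b, hence on no basis. *)
Lemma covec_minor_ext m b w : all off b ->
  (forall x, m x != pzero -> count off x <= size b) ->
  covec m (map h w ++ b) = sm_act (incl_mx F h) (covec (minor m b) w).
Proof.
move=> offb maxb; rewrite covec_minor incl_act_tr // => e.
rewrite ffunE => /maxb /=; rewrite count_cat.
move: offb; rewrite all_count => /eqP ->.
case: (boolP (e \in codom h)) => [/codomhP // |_].
by rewrite add1n ltnNge leq_addl.
Qed.

End Minors.

(** * Signs of arrangements *)

Section Arrangements.
Variable (E : finType).
Implicit Types (s u v : seq E) (a c e : E).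

Lemma map_tperm_swap u a c v : uniq (u ++ a :: c :: v) ->
  map (tperm a c) (u ++ a :: c :: v) = u ++ c :: a :: v.
Proof.
rewrite cat_uniq [has _ _]/= !cons_uniq inE !negb_or => /and5P[_ /and3P[au cu _] /andP[ac av] cv _].
rewrite map_cat /= tpermL tpermR; congr (_ ++ _ :: _ :: _);
  rewrite -[RHS]map_id; apply/eq_in_map => e ev; rewrite tpermD //;
  by apply: contraTneq ev => <-.
Qed.

Lemma perm_of_seqE s e : perm_eq s (enum E) ->
  perm_of_seq s e = nth e s (index e (enum E)).
Proof.
move=> sE; have Us : uniq s by rewrite (perm_uniq sE) enum_uniq.
have ss : size s = size (enum E) by apply: perm_size.
have ltE e' : index e' (enum E) < size s by rewrite ss index_mem mem_enum.
set f := [ffun e => nth e s (index e (enum E))].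
have fI : injectiveb f.
  apply/injectiveP => e1 e2; rewrite !ffunE (set_nth_default e1 e2) //.
  move/eqP; rewrite nth_uniq // => /eqP i12.
  by rewrite -(nth_index e1 (mem_enum E e1)) i12 nth_index ?mem_enum.
by rewrite /perm_of_seq /insubd insubT /= -pvalE /= ffunE.
Qed.

Lemma perm_of_seq_map s (f : {perm E}) : perm_eq s (enum E) ->
  perm_of_seq (map f s) = (perm_of_seq s * f)%g.
Proof.
move=> sE; have fsE : perm_eq (map f s) (enum E).
  apply: uniq_perm; rewrite ?enum_uniq //.
    by rewrite (map_inj_uniq (@perm_inj _ f)) (perm_uniq sE) enum_uniq.
  by move=> e; rewrite mem_enum -(permKV f e) map_f // (perm_mem sE) mem_enum.
apply/permP => e; rewrite permM !perm_of_seqE // (nth_map e) //.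
by rewrite (perm_size sE) index_mem mem_enum.
Qed.

Lemma perm_of_seq_enum : perm_of_seq (enum E) = 1%g.
Proof. by apply/permP => e; rewrite perm_of_seqE // nth_index ?mem_enum // perm1. Qed.

Variable F : idyllType.

Definition arr_sgn s : F := sgn (odd_perm (perm_of_seq s)).

Lemma arr_sgn_swap u a c v : perm_eq (u ++ a :: c :: v) (enum E) ->
  arr_sgn (u ++ a :: c :: v) = (opp 1 * arr_sgn (u ++ c :: a :: v))%g.
Proof.
move=> sE; have U : uniq (u ++ a :: c :: v) by rewrite (perm_uniq sE) enum_uniq.
have ac : a != c.
  by move: (U); rewrite cat_uniq => /and3P[_ _]; rewrite cons_uniq inE negb_or => /andP[/andP[]].
rewrite -(@map_tperm_swap u a c v) // /arr_sgn perm_of_seq_map // odd_permM odd_tperm ac.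
by rewrite -[opp 1%g]/(sgn true) -sgnD addbC addbK.
Qed.

(** The element e moves past q one adjacent transposition at a time. *)
Lemma arr_sgn_move p q e w : perm_eq (p ++ e :: q ++ w) (enum E) ->
  arr_sgn (p ++ q ++ e :: w) = (sgn (odd (size q)) * arr_sgn (p ++ e :: q ++ w))%g.
Proof.
elim: q p => [|c q IH] p sE; first by rewrite /= mul1g.
have P : perm_eq (p ++ c :: e :: q ++ w) (enum E).
  by apply: perm_trans sE; rewrite perm_cat2l (perm_catCA [:: c] [:: e]).
have := IH (rcons p c); rewrite !cat_rcons /= => -> //.
rewrite arr_sgn_swap // -[opp 1%g]/(sgn true) mulgA -sgnD.
by rewrite addbT.
Qed.

End Arrangements.

(** * Grassmann-Pluecker functions on tuples and on sequences *)

Section TupleGP.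
Variables (F : idyllType) (E : finType).
Implicit Types (e : E).

Definition seq_fun r (mu : {ffun r.-tuple E -> F}) (s : seq E) : F :=
  oapp mu pzero (insub s).

Lemma seq_funE r (mu : {ffun r.-tuple E -> F}) (x : r.-tuple E) :
  seq_fun mu x = mu x.
Proof. by rewrite /seq_fun valK. Qed.

Lemma seq_fun_neq0 r (mu : {ffun r.-tuple E -> F}) s :
  seq_fun mu s != pzero -> size s = r.
Proof. by rewrite /seq_fun; case: insubP => [x /eqP //|]; rewrite eqxx. Qed.

Lemma seq_fun_scale r (mu : {ffun r.-tuple E -> F}) a :
  seq_fun [ffun x => (a * mu x)%g] = (fun s => a * seq_fun mu s)%g.
Proof.
by apply/funext => s; rewrite /seq_fun; case: insubP => [x _ _|_] /=;
   rewrite ?ffunE ?pmulr0.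
Qed.

Lemma seq_fun_of r (m : seq E -> F) : (forall s, m s != pzero -> size s = r) ->
  seq_fun [ffun x : r.-tuple E => m x] = m.
Proof.
move=> mr; apply/funext => s; rewrite /seq_fun.
case: insubP => [x _ /= <-|rs] /=; first by rewrite ffunE.
by apply/esym/eqP; apply: contraNT rs => /mr ->.
Qed.

Lemma val_del_entry r (x : r.+1.-tuple E) k :
  val (del_entry x k) = del_nth k x.
Proof.
have kr := ltn_ord k; case: r x k kr => [|r] x k kr.
  by case: k kr x => -[|//] ? ?; case/tupleP => a x; rewrite tuple0 [x]tuple0.
have e := tnth x ord0.
apply: (@eq_from_nth _ e) => [|i]; rewrite size_tuple.
  by rewrite /del_nth size_cat size_take size_drop size_tuple kr subSS subnKC.
move=> ir; rewrite (nth_map ord0) ?size_enum_ord // (tnth_nth e) /=.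
rewrite nth_enum_ord // /bump /del_nth nth_cat size_take size_tuple kr.
case: ltnP => ik; first by rewrite nth_take.
by rewrite nth_drop addSn subnKC // add1n.
Qed.

(** An adjacent transposition of the entries of x amounts to composing x with
   a transposition of indices, or, as the entries are distinct, to applying
   to them the transposition of two elements. *)
Lemma seq_GP_of_tuple r (mu : {ffun r.-tuple E -> F}) :
  alternating mu -> GP_relations mu -> seq_GP r (seq_fun mu).
Proof.
move=> [muS mu0] muGP.
have muU s : seq_fun mu s != pzero -> uniq s.
  rewrite /seq_fun; case: insubP => [x _ /= <-|]; last by rewrite eqxx.
  by apply: contraNT => /mu0 ->.
split=> // [s|u a c v|e x y]; first exact: seq_fun_neq0.
  have P : perm_eq (u ++ a :: c :: v) (u ++ c :: a :: v).
    by rewrite perm_cat2l (perm_catCA [:: a] [:: c]).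
  have [|U] := boolP (uniq (u ++ a :: c :: v)); last first.
    have /eqP -> : seq_fun mu (u ++ a :: c :: v) == pzero.
      by apply: contraNT U => /muU.
    have /eqP -> : seq_fun mu (u ++ c :: a :: v) == pzero.
      by apply: contraNT U => /muU; rewrite (perm_uniq P).
    by rewrite pmulr0.
  have [sx|sx] := eqVneq (size (u ++ a :: c :: v)) r; last first.
    have /eqP -> : seq_fun mu (u ++ a :: c :: v) == pzero.
      by apply: contraNT sx => /seq_fun_neq0 ->.
    have /eqP -> : seq_fun mu (u ++ c :: a :: v) == pzero.
      by apply: contraNT sx => /seq_fun_neq0 <-; rewrite (perm_size P).
    by rewrite pmulr0.
  move=> U; set s := u ++ a :: c :: v in sx U *.
  have iu : size u < r by rewrite -sx size_cat /= -addSnnS leq_addr.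
  have ic : (size u).+1 < r by rewrite -sx size_cat /= -!addSnnS leq_addr.
  pose x := Tuple (introT eqP sx); pose i := Ordinal iu; pose j := Ordinal ic.
  have xi : tnth x i = a by rewrite (tnth_nth a) /= nth_cat ltnn subnn.
  have xj : tnth x j = c.
    by rewrite (tnth_nth a) /= nth_cat ltnNge leqnSn subSn //= subnn.
  have xI : injective (tnth x).
    move=> k l /eqP; rewrite !(tnth_nth a) nth_uniq ?size_tuple // => /eqP.
    exact: val_inj.
  have := muS x (tperm i j); rewrite odd_tperm (_ : i != j); last first.
    by rewrite -val_eqE /= neq_ltn ltnSn.
  rewrite -(seq_funE _ x) -seq_funE /= -[s]/(val x).
  rewrite (_ : map _ _ = u ++ c :: a :: v).
    by move=> ->; rewrite mulgA -[opp 1%g]/(sgn true) sgn_sq mul1g.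
  rewrite -(@map_tperm_swap _ u a c v) // -/s -[s]/(val x) -[val x]map_tnth_enum.
  rewrite -map_comp; apply: eq_map => k /=.
  by rewrite inj_tperm // xi xj.
have [sx|sx] := eqVneq (size x) r.+1; last first.
  apply: null_all0 => b /mapP[k]; rewrite mem_iota /= add0n => kx ->; apply/eqP.
  apply: contraNT sx => /pmul_neq0P[/pmul_neq0P[_ /seq_fun_neq0 sd] _].
  rewrite -sd /del_nth size_cat size_take size_drop kx subnS.
  by rewrite -addnS prednK ?subn_gt0 // subnKC // ltnW.
have [sy|sy] := eqVneq (size y).+1 r; last first.
  apply: null_all0 => _ /mapP[k _ ->]; apply/eqP.
  by apply: contraNT sy => /pmul_neq0P[_ /seq_fun_neq0 /= ->].
rewrite sx; case: r sy mu muS mu0 muGP muU sx => // r [sy] mu _ _ muGP _ sx.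
have := muGP (Tuple (introT eqP sx)) (Tuple (introT eqP sy)).
rewrite -val_enum_ord -map_comp; congr (null _); apply: eq_map => k /=.
by rewrite -!seq_funE val_del_entry /= (tnth_nth e).
Qed.

(** A function that is alternating under adjacent transpositions is so under all
   permutations: its values on arrangements of the indices vary like the sign
   of the arrangement. *)
Lemma alternating_of_seq r (m : seq E -> F) : seq_GP r m ->
  alternating [ffun x : r.-tuple E => m x].
Proof.
move=> mGP; split=> [x s|x Ux]; rewrite !ffunE; last first.
  by apply/eqP; apply: contraNT Ux => /(gp_uniq mGP).
have As : arr_sgn F (map s (enum 'I_r)) = sgn (odd_perm s).
  by rewrite /arr_sgn perm_of_seq_map // perm_of_seq_enum mul1g.
have A1 : arr_sgn F (enum 'I_r) = 1%g.
  by rewrite /arr_sgn perm_of_seq_enum odd_perm1.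
have := @alternating_mul_perm _ F (fun u => m (map (tnth x) u))
  (@arr_sgn _ F) (enum 'I_r) (map s (enum 'I_r)).
rewrite A1 As mulg1 map_tnth_enum => -> //.
- by rewrite pmulC -mulgA sgn_sq mulg1 -map_comp.
- by move=> u a c v _; rewrite !map_cat /= (gp_swap mGP).
- by move=> u a c v; rewrite perm_sym; apply: arr_sgn_swap.
apply: uniq_perm; rewrite ?(map_inj_uniq (@perm_inj _ s)) ?enum_uniq // => e.
by rewrite mem_enum -(permKV s e) map_f // mem_enum.
Qed.

Lemma GP_relations_of_seq r (m : seq E -> F) : seq_GP r m ->
  GP_relations [ffun x : r.-tuple E => m x].
Proof.
case: r => // r mGP x y; have := gp_rel mGP (tnth x ord0) x y.
rewrite size_tuple -val_enum_ord -map_comp; congr (null _); apply: eq_map => k /=.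
by rewrite !ffunE val_del_entry -tnth_nth.
Qed.

End TupleGP.

(** * Circuits and cocircuits of a matroid *)

Section Cocircuits.
Variables (F : idyllType) (E : finType).
Implicit Types (e : E) (Z : {ffun E -> F}).

Lemma circuit_vecE r (mu : {ffun r.-tuple E -> F}) (y : r.+1.-tuple E) :
  uniq y -> circuit_vec mu y = cvec (seq_fun mu) y.
Proof.
move=> Uy; apply/ffunP => e; rewrite !ffunE; case: pickP => [k /eqP <-|yn].
  rewrite mem_tnth (tnth_nth e) index_uniq ?size_tuple // remE.
  by rewrite index_uniq ?size_tuple // -/(del_nth k y) -val_del_entry seq_funE.
by case: ifP => // /tnthP[k ek]; have := yn k; rewrite ek eqxx.
Qed.

Lemma orth0 Z (Y : {ffun E -> F}) : (forall e, Y e = pzero) -> orthogonal Z Y.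
Proof. by move=> Y0; apply: null_all0 => _ /mapP[e _ ->]; rewrite Y0 pmulr0. Qed.

Lemma cvec0 r (mu : {ffun r.-tuple E -> F}) y e :
  cvec (seq_fun mu) y e != pzero -> size y = r.+1.
Proof.
rewrite ffunE; case: ifP => [ey|_]; last by rewrite eqxx.
move=> /pmul_neq0P[_ /seq_fun_neq0]; rewrite size_rem // => <-.
by rewrite prednK //; case: y ey.
Qed.

(** The circuits differ from the vectors cvec by scalars and by the zero
   vector, which do not affect orthogonality. *)
Lemma orth_circuitsP r (M : set {ffun r.-tuple E -> F}) Z :
  orth_compl (circuits M) Z <->
  forall mu, M mu -> forall y, uniq y -> orthogonal Z (cvec (seq_fun mu) y).
Proof.
split=> [ZM mu Mmu y Uy|ZM X [mu [y [a [Mmu Uy _ a0 ->]]]]].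
  have [[e ye]|y0] := pselect (exists e, cvec (seq_fun mu) y e != pzero); last first.
    by apply: orth0 => e; apply/eqP/negPn/negP => ye; apply: y0; exists e.
  have sy := cvec0 ye; pose t := Tuple (introT eqP sy).
  rewrite -(orthogonal_scale Z _ pone_neq0); apply: ZM.
  exists mu, t, 1%g; split; rewrite ?pone_neq0 ?circuit_vecE //.
  move: ye; rewrite -[y]/(val t) -circuit_vecE // ffunE.
  by case: pickP => [k _ /pmul_neq0P[_]|]; [exists k | rewrite eqxx].
by apply/orthogonal_scale; rewrite // circuit_vecE //; apply: ZM.
Qed.

(** Up to a sign, the circuits of the dual are the vectors e |-> mu(e, w):
   if z and w are complementary, the dual evaluated at z without e is, up to
   the sign of an arrangement, mu at w with e put back. *)
Lemma cvec_dual r (mu : {ffun r.-tuple E -> F}) z w : seq_GP r (seq_fun mu) ->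
  size z = (#|E| - r).+1 -> perm_eq (z ++ w) (enum E) ->
  exists c : bool, cvec (seq_fun (dual_fun mu)) z =
    [ffun e => (sgn c * covec (seq_fun mu) w e)%g].
Proof.
move=> muGP sz zwE.
have Uzw : uniq (z ++ w) by rewrite (perm_uniq zwE) enum_uniq.
have /and3P[Uz zw Uw] : [&& uniq z, ~~ has (mem z) w & uniq w].
  by rewrite -cat_uniq.
exists (odd (size z).-1 (+) odd_perm (perm_of_seq (z ++ w))).
apply/ffunP => e; rewrite !ffunE; have [ez|ez] := boolP (e \in z); last first.
  suff /eqP -> : seq_fun mu (e :: w) == pzero by rewrite pmulr0.
  apply/negPn/negP => /(gp_uniq muGP) /= /andP[ew _].
  have : e \in z ++ w by rewrite (perm_mem zwE) mem_enum.
  by rewrite mem_cat (negbTE ez) (negbTE ew).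
set k := index e z; have kz : k < size z by rewrite index_mem.
have zE : z = take k z ++ e :: drop k.+1 z.
  by rewrite -{1}(nth_index e ez) -/k -drop_nth // cat_take_drop.
set x := rem e z; have xE : x = take k z ++ drop k.+1 z by rewrite /x remE.
have sx : size x = #|E| - r by rewrite size_rem // sz.
have Ux : uniq x by rewrite rem_uniq.
have -> : seq_fun (dual_fun mu) x =
    (arr_sgn F (x ++ [seq e' <- enum E | e' \notin x]) *
     seq_fun mu [seq e' <- enum E | e' \notin x])%g.
  have -> : seq_fun (dual_fun mu) x = dual_fun mu (Tuple (introT eqP sx)).
    by rewrite -seq_funE.
  by rewrite ffunE /= Ux.
have P : perm_eq [seq e' <- enum E | e' \notin x] (e :: w).
  apply: uniq_perm; first by rewrite filter_uniq // enum_uniq.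
    by rewrite /= Uw andbT; apply: contra zw => ew; apply/hasP; exists e.
  move=> e'; rewrite mem_filter mem_enum andbT mem_rem_uniq // !inE negb_and negbK.
  case: eqVneq => //= _; have : e' \in z ++ w by rewrite (perm_mem zwE) mem_enum.
  rewrite mem_cat; case: (boolP (e' \in z)) => //= ez' _; apply/esym/negbTE.
  by apply: contra zw => ew; apply/hasP; exists e'.
have xE' : perm_eq (x ++ e :: w) (enum E).
  apply: perm_trans zwE; rewrite [in X in perm_eq _ X]zE xE -!catA perm_cat2l.
  by rewrite (perm_catCA _ [:: e]).
rewrite (@alternating_mul_perm _ F (fun u => arr_sgn F (x ++ u)) (seq_fun mu)
   _ (e :: w)) //; first last.
- by move=> u a c v _; rewrite (gp_swap muGP).
- move=> u a c v uE; rewrite !catA arr_sgn_swap // -!catA.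
  by apply: perm_trans xE'; rewrite perm_cat2l perm_sym; apply: perm_trans uE; rewrite perm_sym.
rewrite xE -catA arr_sgn_move; last by rewrite -cat_cons catA -zE.
rewrite -cat_cons catA -zE !mulgA /arr_sgn -!sgnD; congr (sgn (_ (+) _) * _)%g.
rewrite -oddD size_drop; congr odd.
by rewrite subnS -subn1 addnBA ?subn_gt0 // subnKC 1?ltnW // subn1.
Qed.

Lemma orth_dualP r (M : set {ffun r.-tuple E -> F}) Z : r <= #|E| ->
  (forall mu, M mu -> seq_GP r (seq_fun mu)) ->
  vectors M Z <->
  forall mu, M mu -> forall w, orthogonal Z (covec (seq_fun mu) w).
Proof.
move=> rE MGP; rewrite /vectors orth_circuitsP; split=> [ZM mu Mmu w|ZM].
  have [[e we]|w0] := pselect (exists e, covec (seq_fun mu) w e != pzero); last first.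
    by apply: orth0 => e; apply/eqP/negPn/negP => we; apply: w0; exists e.
  move: we; rewrite ffunE => mew; have muGP := MGP _ Mmu.
  have /= /andP[_ Uw] := gp_uniq muGP mew; have /= sw := gp_size muGP mew.
  pose z := [seq e <- enum E | e \notin w].
  have zw : perm_eq (z ++ w) (enum E).
    apply: uniq_perm => [||e']; rewrite ?enum_uniq //.
      rewrite cat_uniq (filter_uniq _ (enum_uniq E)) Uw andbT /=.
      by apply/hasPn => e'; rewrite mem_filter => ->.
    by rewrite mem_cat mem_filter mem_enum andbT orNb.
  have sz : size z = (#|E| - r).+1.
    have := perm_size zw; rewrite size_cat -cardE => zwE.
    rewrite -sw in rE *; rewrite subnS prednK ?subn_gt0 //.
    by rewrite -zwE addnK.
  have [c zc] := cvec_dual muGP sz zw.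
  rewrite -(orthogonal_scale _ _ (sgn_neq0 F c)) -zc; apply: ZM.
    by exists mu.
  exact: filter_uniq (enum_uniq E).
move=> _ [mu Mmu <-] z Uz; have muGP := MGP _ Mmu.
have [[e ze]|z0] := pselect (exists e, cvec (seq_fun (dual_fun mu)) z e != pzero); last first.
  by apply: orth0 => e; apply/eqP/negPn/negP => ze; apply: z0; exists e.
have sz := cvec0 ze; pose w := [seq e <- enum E | e \notin z].
have zw : perm_eq (z ++ w) (enum E).
  apply: uniq_perm => [||e']; rewrite ?enum_uniq //.
    rewrite cat_uniq Uz (filter_uniq _ (enum_uniq E)) andbT /=.
    by apply/hasPn => e'; rewrite mem_filter => /andP[].
  by rewrite mem_cat mem_filter mem_enum andbT orbN.
have [c ->] := cvec_dual muGP sz zw.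
by apply/orthogonal_scale; rewrite ?sgn_neq0 //; apply: ZM.
Qed.

End Cocircuits.

(** * Pointed matroids and their minors *)

Section AddPoint.
Variables (F : idyllType) (E : finType) (r : nat) (m : seq E -> F).
Hypothesis mGP : seq_GP r m.

Definition add_pt (x : seq (option E)) : F :=
  if None \in x then pzero else m (pmap id x).

Lemma map_Some_pmap (x : seq (option E)) :
  None \notin x -> map Some (pmap id x) = x.
Proof. by elim: x => [|[a|] x IH] //; rewrite inE /= => /IH ->. Qed.

Lemma pmap_map_Some (x : seq E) : pmap id (map Some x) = x.
Proof. by elim: x => //= a x ->. Qed.

Lemma None_notin_map (x : seq E) : None \notin map Some x.
Proof. by apply/negP => /mapP[]. Qed.

Lemma add_pt_Some x : add_pt (map Some x) = m x.
Proof. by rewrite /add_pt (negbTE (None_notin_map _)) pmap_map_Some. Qed.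

Lemma add_pt_neq0 x : add_pt x != pzero -> exists2 x', x = map Some x' & m x' != pzero.
Proof.
rewrite /add_pt; case: ifP => [_|/negbT xN]; first by rewrite eqxx.
by exists (pmap id x); rewrite ?map_Some_pmap.
Qed.

Lemma seq_GP_add_pt : seq_GP r add_pt.
Proof.
split.
- by move=> x /add_pt_neq0[x' -> /(gp_size mGP)]; rewrite size_map.
- move=> x /add_pt_neq0[x' -> /(gp_uniq mGP)].
  by rewrite map_inj_uniq // => ? ? [].
- move=> u a c v; rewrite /add_pt.
  have -> : (None \in u ++ a :: c :: v) = (None \in u ++ c :: a :: v).
    by apply/perm_mem; rewrite perm_cat2l (perm_catCA [:: a] [:: c]).
  case: ifP => [_|]; first by rewrite pmulr0.
  case: a c => [a|] [c|]; rewrite ?mem_cat ?inE ?orbT // => _.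
  by rewrite !pmap_cat /= (gp_swap mGP).
move=> e x y.
have [yN|yN] := boolP (None \in y).
  apply: null_all0 => _ /mapP[k _ ->].
  by rewrite {2}/add_pt inE yN orbT pmulr0.
have [xN|xN] := boolP (None \in x).
  apply: null_all0 => b /mapP[k]; rewrite mem_iota /= add0n => kx ->.
  have [kN|kN] := eqVneq (nth e x k) None.
    by rewrite kN {2}/add_pt inE eqxx pmulr0.
  suff kN' : None \in del_nth k x by rewrite {1}/add_pt kN' pmulr0 pmul0.
  move: xN; rewrite -{1}(cat_take_drop k x) (drop_nth e) // mem_cat inE.
  by rewrite eq_sym (negbTE kN) /= -mem_cat.
rewrite -(map_Some_pmap xN) -(map_Some_pmap yN).
case: (pmap id x) (pmap id y) => [|e' x'] y'; first exact: null_nil.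
move: (e' :: x') => x1; have := gp_rel mGP e' x1 y'; rewrite size_map.
congr (null _); apply/eq_in_map => k; rewrite mem_iota /= add0n => kx.
by rewrite del_nth_map add_pt_Some (nth_map e') // -map_cons add_pt_Some.
Qed.

Hypothesis m_neq0 : exists x, m x != pzero.

Lemma is_matroid_seq : is_matroid (scale_class [ffun x : r.-tuple E => m x]).
Proof.
exists [ffun x : r.-tuple E => m x] => //; split.
- have [x mx] := m_neq0; exists (Tuple (introT eqP (gp_size mGP mx))).
  by rewrite ffunE.
- exact: alternating_of_seq.
exact: GP_relations_of_seq.
Qed.

End AddPoint.

Section Objects.
Variable F : idyllType.
Implicit Types (M : pointedMatroid F).

Definition scale_seq (T : Type) (m : T -> F) : set (T -> F) :=
  [set m' | exists2 a : F, a != pzero & m' = (fun x => a * m x)%g].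

Section OfSeq.
Variables (E : finType) (r : nat) (m : seq E -> F).
Hypotheses (mGP : seq_GP r m) (m_neq0 : exists x, m x != pzero).

Let mu : {ffun r.-tuple (option E) -> F} := [ffun x => add_pt m (val x)].

Fact matroid_of_seq_subproof : is_matroid (scale_class mu).
Proof.
apply: is_matroid_seq; first exact: seq_GP_add_pt.
by have [x mx] := m_neq0; exists (map Some x); rewrite add_pt_Some.
Qed.

Fact matroid_of_seq_pt nu : scale_class mu nu ->
  forall x : r.-tuple (option E), None \in x -> nu x = pzero.
Proof. by move=> [a _ ->] x xN; rewrite !ffunE /add_pt xN pmulr0. Qed.

Definition matroid_of_seq : pointedMatroid F :=
  PointedMatroid matroid_of_seq_subproof matroid_of_seq_pt.

End OfSeq.

Definition gp_funs M : set (seq (tground M) -> F) :=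
  [set seq_fun mu | mu in delete_pt M].

Lemma gp_funs_of_seq (E : finType) r (m : seq E -> F)
    (mGP : seq_GP r m) (m0 : exists x, m x != pzero) :
  @gp_funs (matroid_of_seq mGP m0) = scale_seq m.
Proof.
have seqE a : seq_fun [ffun x : r.-tuple E => (a * m x)%g] = (fun x => a * m x)%g.
  by apply: seq_fun_of => s; apply: gp_size (seq_GP_scale a mGP) s.
apply/seteqP; split=> [_ [_ [_ [a a0 ->] <-] <-]|_ [a a0 ->]].
  exists a => //; rewrite -seqE; congr (seq_fun _).
  by apply/ffunP => x; rewrite !ffunE /= add_pt_Some.
exists [ffun x : r.-tuple E => (a * m x)%g]; last exact: seqE.
exists [ffun x : r.-tuple (option E) => (a * [ffun x => add_pt m (val x)] x)%g].
  by exists a.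
by apply/ffunP => x; rewrite !ffunE /= add_pt_Some.
Qed.

Lemma gp_fun_exists M : exists m : seq (tground M) -> F,
  [/\ seq_GP (prank M) m, exists x, m x != pzero,
      @gp_funs M = scale_seq m & is_matroid (delete_pt M)].
Proof.
have [mu0 [[x0 x00] mu0A mu0R] MmuE] := pclass_matroid M.
have muGP := seq_GP_of_tuple mu0A mu0R.
pose m := minor Some (seq_fun mu0) [::].
have mGP : seq_GP (prank M) m.
  by apply: seq_GP_minor; rewrite ?addn0 // => ? ? [].
have mE (x : (prank M).-tuple (tground M)) : m x = mu0 (map_tuple Some x).
  by rewrite -seq_funE /m /minor cats0.
have m0 : exists x, m x != pzero.
  exists (pmap id x0); rewrite /m /minor cats0 map_Some_pmap ?seq_funE //.
  apply/negP => x0N; move: x00; rewrite (@pclass_pt _ M mu0) ?eqxx // MmuE.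
  by exists 1%g; [apply: pone_neq0 | apply/ffunP => x; rewrite ffunE mul1g].
have dE : delete_pt M = scale_class [ffun x : (prank M).-tuple _ => m x].
  rewrite /delete_pt MmuE; apply/seteqP; split=> [_ [_ [a a0 ->] <-]|_ [a a0 ->]].
    by exists a => //; apply/ffunP => x; rewrite !ffunE mE.
  exists [ffun x => (a * mu0 x)%g]; first by exists a.
  by apply/ffunP => x; rewrite !ffunE mE.
exists m; split=> //; last by rewrite dE; apply: is_matroid_seq.
rewrite /gp_funs dE; apply/seteqP; split=> [_ [_ [a a0 ->] <-]|_ [a a0 ->]].
  by exists a => //; rewrite seq_fun_scale seq_fun_of //; apply: gp_size mGP.
exists [ffun x => (a * [ffun x : (prank M).-tuple _ => m x] x)%g]; first by exists a.
by rewrite seq_fun_scale seq_fun_of //; apply: gp_size mGP.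
Qed.

(** The circuits and, in coc, the cocircuits, up to the presence of the zero
   vector: it saves a side condition and changes no orthogonal complement. *)
Definition cir M : set {ffun tground M -> F} :=
  [set X | exists m y, [/\ @gp_funs M m, uniq y & X = cvec m y]].

Definition coc M : set {ffun tground M -> F} :=
  [set X | exists m w, @gp_funs M m /\ X = covec m w].

Lemma gp_fun_GP M m : @gp_funs M m -> seq_GP (prank M) m.
Proof.
by have [m0 [m0GP _ -> _]] := gp_fun_exists M; case=> a a0 ->; apply: seq_GP_scale.
Qed.

Lemma pvectorsE M : pvectors M = orth_compl (@coc M).
Proof.
have [m [mGP [x mx] _ _]] := gp_fun_exists M.
have rE : prank M <= #|tground M|.
  by rewrite -(gp_size mGP mx) -(card_uniqP (gp_uniq mGP mx)) max_card.
have dGP mu : delete_pt M mu -> seq_GP (prank M) (seq_fun mu).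
  by move=> Mmu; apply: gp_fun_GP; exists mu.
apply/seteqP; split=> X.
  move=> /(orth_dualP X rE dGP) XM _ [_ [w [[mu Mmu <-] ->]]]; exact: XM.
move=> XM; apply/(orth_dualP X rE dGP) => mu Mmu w; apply: XM.
by exists (seq_fun mu), w; split=> //; exists mu.
Qed.

Lemma pcovectorsE M : covectors (delete_pt M) = orth_compl (@cir M).
Proof.
apply/seteqP; split=> X.
  move=> /(orth_circuitsP _ X) XM _ [_ [y [[mu Mmu <-] Uy ->]]]; exact: XM.
move=> XM; apply/(orth_circuitsP _ X) => mu Mmu y Uy; apply: XM.
by exists (seq_fun mu), y; split=> //; exists mu.
Qed.

Lemma perfect_orth M X Z : perfect F ->
  orth_compl (@coc M) X -> orth_compl (@cir M) Z -> orthogonal X Z.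
Proof.
move=> hF; rewrite -pvectorsE -pcovectorsE.
by have [_ [_ _ _ dM]] := gp_fun_exists M; apply: hF.
Qed.

Lemma cir_coc_orth M X Y : @cir M X -> @coc M Y -> orthogonal X Y.
Proof.
have [m0 [m0GP _ gE _]] := gp_fun_exists M.
rewrite /cir /coc gE => -[_ [y [[a a0 ->] Uy ->]]] [_ [w [[b b0 ->] ->]]].
rewrite cvec_scale covec_scale orthogonal_scale // orthogonalC.
by rewrite orthogonal_scale // orthogonalC; apply: cvec_covec_orth m0GP Uy.
Qed.

(** * Restriction and contraction *)

Section MinorObjects.
Variables (M : pointedMatroid F) (E' : finType) (h : E' -> tground M).
Hypothesis hI : injective h.
Let E := tground M.
Let off := [pred e : E | e \notin codom h].

Lemma map_codom (s : seq E) : all (mem (codom h)) s -> exists s', s = map h s'.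
Proof.
elim: s => [|e s IH] /=; first by exists [::].
by case/andP=> /codomP[e' ->] /IH[s' ->]; exists (e' :: s').
Qed.

(** Reordering the basis x puts its entries off E' last; they form b, and the
   other entries show that the minor is not identically zero. *)
Lemma minor_of_basis (m : seq E -> F) x : gp_funs m -> m x != pzero ->
  exists (b : seq E) (R : pointedMatroid F) (i : tground R -> E),
    [/\ injective i /\ codom i =i codom h, all off b, uniq b, size b = count off x &
        @gp_funs R = [set minor i m' b | m' in @gp_funs M]].
Proof.
move=> Mm mx; have mGP := gp_fun_GP Mm; pose b := filter off x.
have [y yE] : exists y, filter (mem (codom h)) x = map h y.
  by apply: map_codom; apply: filter_all.
have yb : perm_eq x (map h y ++ b).
  rewrite -yE perm_sym perm_catC (_ : filter (mem (codom h)) x = filter (predC off) x).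
    by rewrite perm_filterC.
  by apply: eq_filter => e /=; rewrite negbK.
have my : minor h m b y != pzero by apply: gp_neq0_perm mGP yb mx.
have m'GP : seq_GP (size y) (minor h m b).
  apply: (seq_GP_minor hI); rewrite -(size_map h) -size_cat -(perm_size yb).
  by rewrite (gp_size mGP mx).
have m'0 : exists x, minor h m b x != pzero by exists y.
exists b, (matroid_of_seq m'GP m'0), h; split=> //.
- exact: filter_all.
- by have := gp_uniq mGP mx; rewrite (perm_uniq yb) cat_uniq => /and3P[].
- exact: size_filter.
have [m0 [_ _ gE _]] := gp_fun_exists M.
rewrite gp_funs_of_seq gE; move: Mm; rewrite gE => -[c c0 mcE].
have mE z : m z = (c * m0 z)%g by rewrite mcE.
apply/seteqP; split=> [_ [a a0 ->]|_ [_ [a a0 ->] <-]].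
  exists (fun x => a * c * m0 x)%g.
    by exists (a * c)%g; rewrite // pmul_eq0 negb_or a0.
  by apply/funext => z; rewrite /minor mE mulgA.
exists (a * pinv c)%g; first by rewrite pmul_eq0 negb_or a0 pinv_neq0.
apply/funext => z; rewrite /minor mE !mulgA -(mulgA a) (pmulC (pinv c)).
by rewrite pmulV // mulg1.
Qed.

End MinorObjects.

(** With circuits for c and cocircuits for d, these two properties single out
   the restriction of A to K; with the roles exchanged, the contraction.  In
   both cases the vectors of c R stay of the same kind when extended by 0,
   while those of d R are only restrictions of vectors of d A. *)
Definition is_minor (T : Type) (g : T -> finType)
    (c d : forall A, set {ffun g A -> F}) (A : T) (K : {set g A}) : Prop :=
  exists (R : T) (i : g R -> g A),
    [/\ injective i, codom i =i K,
        forall X, c R X -> c A (sm_act (incl_mx F i) X) &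
        forall Y, d R Y -> exists2 Y', d A Y' & Y = [ffun e => Y' (i e)]].

Section ExtremalBases.
Variables (M : pointedMatroid F) (K : {set tground M}).
Let off := [pred e | e \notin K].
Let bases n := exists m x, [/\ @gp_funs M m, m x != pzero & count off x = n].

Lemma basis_exists : exists n, `[< bases n >].
Proof.
have [m [_ [x mx] gE _]] := gp_fun_exists M.
exists (count off x); apply/asboolP; exists m, x; split=> //; rewrite gE.
by exists 1%g; rewrite ?pone_neq0 //; apply/funext => z; rewrite mul1g.
Qed.

Lemma min_basis : exists m x, [/\ @gp_funs M m, m x != pzero &
  forall m' x', @gp_funs M m' -> m' x' != pzero -> count off x <= count off x'].
Proof.
case: (ex_minnP basis_exists) => n /asboolP[m [x [Mm mx <-]]] min.
by exists m, x; split=> // m' x' Mm' mx'; apply/min/asboolP; exists m', x'.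
Qed.

Lemma max_basis : exists m x, [/\ @gp_funs M m, m x != pzero &
  forall m' x', @gp_funs M m' -> m' x' != pzero -> count off x' <= count off x].
Proof.
have ub n : `[< bases n >] -> n <= prank M.
  move=> /asboolP[m [x [Mm mx <-]]].
  by rewrite -(gp_size (gp_fun_GP Mm) mx) count_size.
case: (ex_maxnP basis_exists ub) => n /asboolP[m [x [Mm mx <-]]] max.
by exists m, x; split=> // m' x' Mm' mx'; apply/max/asboolP; exists m', x'.
Qed.

Let h (e : {e | e \in K}) := val e.

Lemma codom_val_set : codom h =i K.
Proof.
move=> e; apply/codomP/idP => [[e' ->]|eK]; first exact: (valP e').
by exists (exist _ e eK).
Qed.

Lemma off_codom (E' : finType) (i : E' -> tground M) :
  codom i =i codom h -> [pred e | e \notin codom i] =1 off.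
Proof. by move=> ih e; rewrite /= ih codom_val_set. Qed.

Lemma uniq_minor_cat (E' : finType) (i : E' -> tground M) (b : seq (tground M)) y :
  injective i -> uniq b -> all [pred e | e \notin codom i] b -> uniq y ->
  uniq (map i y ++ b).
Proof.
move=> iI Ub offb Uy; rewrite cat_uniq map_inj_uniq // Uy Ub andbT /=.
apply/hasPn => e /(allP offb) /=; apply: contra => /mapP[j _ ->].
exact: codom_f.
Qed.

(** Deleting the complement of K may lower the rank, so that the elements off K
   of some basis have to be contracted; with as few of them as possible, the
   lifted circuits vanish off K. *)
Lemma restriction_exists : is_minor (@cir) (@coc) K.
Proof.
have [m [x [Mm mx min]]] := min_basis.
have [b [R [i [[iI ih] offb Ub sb RE]]]] := minor_of_basis (h := h) val_inj Mm mx.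
have offE := off_codom ih; have offE' := off_codom (frefl _).
exists R, i; split=> // [e|X [mR [y [+ Uy ->]]]|Y [mR [w [+ ->]]]].
- by rewrite ih codom_val_set.
- rewrite RE => -[m' Mm' <-].
  have offb' : all [pred e | e \notin codom i] b.
    by rewrite (eq_all offE) -(eq_all offE').
  exists m', (map i y ++ b); split=> //; first exact: uniq_minor_cat.
  rewrite (cvec_minor_ext iI) // => x' mx'; rewrite sb (eq_count offE').
  by rewrite (eq_count offE); apply: min mx'.
rewrite RE => -[m' Mm' <-]; rewrite covec_minor.
by exists (covec m' (map i w ++ b)) => //; exists m', (map i w ++ b).
Qed.

(** With as many elements off K as possible in the contracted tuple, the others
   become loops, and the lifted cocircuits vanish off K. *)
Lemma contraction_exists : is_minor (@coc) (@cir) K.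
Proof.
have [m [x [Mm mx max]]] := max_basis.
have [b [R [i [[iI ih] offb Ub sb RE]]]] := minor_of_basis (h := h) val_inj Mm mx.
have offE := off_codom ih; have offE' := off_codom (frefl _).
have offb' : all [pred e | e \notin codom i] b.
  by rewrite (eq_all offE) -(eq_all offE').
exists R, i; split=> // [e|X [mR [w [+ ->]]]|Y [mR [y [+ Uy ->]]]].
- by rewrite ih codom_val_set.
- rewrite RE => -[m' Mm' <-]; exists m', (map i w ++ b); split=> //.
  rewrite (covec_minor_ext iI) // => x' mx'; rewrite sb (eq_count offE').
  by rewrite (eq_count offE); apply: max mx'.
rewrite RE => -[m' Mm' <-]; rewrite (cvec_minor iI) => [|j]; last first.
  by apply/negP => /(allP offb') /=; rewrite codom_f.
exists (cvec m' (map i y ++ b)) => //; exists m', (map i y ++ b); split=> //.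
exact: uniq_minor_cat.
Qed.

End ExtremalBases.

Lemma inhabited_matroid : inhabited (pointedMatroid F).
Proof.
pose m (x : seq void) : F := 1%g.
have mGP : seq_GP 0 m.
  split=> [[]//|[]//|u []//|e].
  by case: e.
by apply: (inhabits (matroid_of_seq mGP _)); exists [::]; apply: pone_neq0.
Qed.

End Objects.

(** * Submonomial matrices up to their partial inverses *)

Section PartialInverse.
Variable F : idyllType.
Implicit Types I J K : finType.

Definition sm_zero I J : {ffun I * J -> F} := [ffun=> pzero].

Lemma submonomial_zero I J : submonomial (sm_zero I J).
Proof. by split=> ? ? ?; rewrite ffunE eqxx. Qed.

Lemma sm_act_zero I J X : sm_act (sm_zero I J) X = [ffun=> pzero].
Proof. by apply/ffunP => i; rewrite !ffunE fsum_zero // => j; rewrite ffunE pmul0. Qed.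

Lemma sm_mul_row I J K (g : {ffun I * J -> F}) (f : {ffun J * K -> F}) i j k :
  submonomial g -> g (i, j) != pzero -> sm_mul g f (i, k) = (g (i, j) * f (j, k))%g.
Proof.
move=> [gr _] gij; rewrite ffunE (fsum_single (i0 := j)) //= => j' /pmul_neq0P[g' _].
exact: gr g' gij.
Qed.

Lemma sm_mul_neq0I I J K (g : {ffun I * J -> F}) (f : {ffun J * K -> F}) i j k :
  submonomial g -> g (i, j) != pzero -> f (j, k) != pzero ->
  sm_mul g f (i, k) != pzero.
Proof. by move=> gS gij fjk; rewrite (sm_mul_row _ _ gS gij) pmul_neq0. Qed.

Definition sm_inv I J (f : {ffun I * J -> F}) : {ffun J * I -> F} :=
  [ffun p => let a := f (p.2, p.1) in if a == pzero then pzero else pinv a].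

Lemma sm_invE I J (f : {ffun I * J -> F}) i j : f (i, j) != pzero ->
  sm_inv f (j, i) = pinv (f (i, j)).
Proof. by move=> fij; rewrite ffunE /= (negbTE fij). Qed.

Lemma sm_inv_neq0 I J (f : {ffun I * J -> F}) i j :
  (sm_inv f (j, i) != pzero) = (f (i, j) != pzero).
Proof.
rewrite ffunE /=; case: (eqVneq (f (i, j))) => [_|f0]; first by rewrite eqxx.
by rewrite pinv_neq0.
Qed.

Lemma submonomial_inv I J (f : {ffun I * J -> F}) :
  submonomial f -> submonomial (sm_inv f).
Proof.
by case=> fr fc; split=> ? ? ?; rewrite !sm_inv_neq0; [apply: fc|apply: fr].
Qed.

Lemma sm_inv_mul I J (f : {ffun I * J -> F}) : submonomial f ->
  (forall j, exists i, f (i, j) != pzero) -> sm_mul (sm_inv f) f = sm_one F J.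
Proof.
move=> fS fj; apply/ffunP => -[j k]; have [i fij] := fj j.
rewrite (@sm_mul_row _ _ _ _ _ _ i) ?sm_inv_neq0 //; last exact: submonomial_inv.
rewrite sm_invE // ffunE /=; case: eqVneq => [<-|jk].
  by rewrite pmulC pmulV.
have /eqP -> : f (i, k) == pzero; last exact: pmulr0.
by apply: contraNT jk => fik; rewrite (fS.1 _ _ _ fij fik).
Qed.

Lemma sm_mul_inv I J K (f : {ffun I * J -> F}) (u : {ffun I * K -> F}) :
  submonomial f ->
  (forall i k, u (i, k) != pzero -> exists j, f (i, j) != pzero) ->
  sm_mul f (sm_mul (sm_inv f) u) = u.
Proof.
move=> fS uf; apply/ffunP => -[i k].
have [[j fij]|fi] := pselect (exists j, f (i, j) != pzero).
  rewrite (sm_mul_row _ _ fS fij) (@sm_mul_row _ _ _ _ _ _ i) ?sm_inv_neq0 //.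
    by rewrite sm_invE // mulgA pmulV // mul1g.
  exact: submonomial_inv.
have -> : u (i, k) = pzero by apply/eqP/negPn/negP => /uf.
by apply/eqP/negPn/negP => /sm_mul_neq0[j fij _]; apply: fi; exists j.
Qed.

End PartialInverse.

(** * Matrix categories *)

(** A category whose morphisms are the submonomial matrices that preserve the
   vectors, the vectors being orthogonal to the cocircuits.  The axioms are
   those facts on matroids from which the theorem follows; they are stable
   under reversing the arrows, transposing the matrices and exchanging
   circuits and cocircuits, so that every statement below has a dual. *)
Record matcat (F : idyllType) := MatCat {
  mc_cat :> category;
  gr : mc_cat -> finType;
  mc_cir : forall A, set {ffun gr A -> F};
  mc_coc : forall A, set {ffun gr A -> F};
  mx : forall A B : mc_cat, hom A B -> {ffun gr B * gr A -> F};
  mx_inj : forall (A B : mc_cat) (f g : hom A B), mx f = mx g -> f = g;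
  mx_id : forall A : mc_cat, mx (idc A) = sm_one F (gr A);
  mx_comp : forall (A B D : mc_cat) (g : hom B D) (f : hom A B),
    mx (comp g f) = sm_mul (mx g) (mx f);
  mx_homP : forall (A B : mc_cat) (f : {ffun gr B * gr A -> F}),
    (exists h : hom A B, mx h = f) <->
    submonomial f /\ (forall X, orth_compl (@mc_coc A) X ->
                                orth_compl (@mc_coc B) (sm_act f X));
  mc_orth : forall A X Y, @mc_cir A X -> @mc_coc A Y -> orthogonal X Y;
  mc_perfect : forall A X Z, orth_compl (@mc_coc A) X ->
    orth_compl (@mc_cir A) Z -> orthogonal X Z;
  mc_inh : inhabited mc_cat;
  mc_restr : forall A (K : {set gr A}), is_minor mc_cir mc_coc K;
  mc_contr : forall A (K : {set gr A}), is_minor mc_coc mc_cir K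
}.

Section MatrixCategory.
Variables (F : idyllType) (S : matcat F).
Implicit Types A B D K M N R T : S.

Definition vec A : set {ffun gr A -> F} := orth_compl (@mc_coc F S A).
Definition covect A : set {ffun gr A -> F} := orth_compl (@mc_cir F S A).

Lemma mx_submonomial A B (f : hom A B) : submonomial (mx f).
Proof. by have [] := (mx_homP (mx f)).1 (ex_intro _ f erefl). Qed.

Lemma mx_vec A B (f : hom A B) X : vec X -> vec (sm_act (mx f) X).
Proof. by have [_] := (mx_homP (mx f)).1 (ex_intro _ f erefl); apply. Qed.

Lemma cir_vec A X : @mc_cir F S A X -> vec X.
Proof. by move=> XA Y YA; apply: mc_orth YA. Qed.

(** Cocircuits are covectors by the Grassmann-Pluecker relations, so that for
   a perfect idyll vectors and covectors determine each other. *)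
Lemma vecP A (X : {ffun gr A -> F}) :
  vec X <-> forall Z, covect Z -> orthogonal X Z.
Proof.
split=> [XA Z ZA|XZ Y YA]; first exact: mc_perfect.
by apply: XZ => Z ZA; apply/orthogonalC/(mc_orth ZA YA).
Qed.

(** The transpose of a morphism is a morphism of the duals. *)
Lemma mx_covect A B (f : hom A B) Z :
  covect Z -> covect (sm_act (sm_tr (mx f)) Z).
Proof.
move=> ZB X XA; apply/orthogonalC/(orthogonal_act _ _ (mx_submonomial f)).
by apply: mc_perfect ZB; apply/mx_vec/cir_vec.
Qed.

Lemma mx_act_comp A B D (g : hom B D) (f : hom A B) X :
  sm_act (mx (comp g f)) X = sm_act (mx g) (sm_act (mx f) X).
Proof. by rewrite mx_comp; apply: sm_act_mul; apply: mx_submonomial. Qed.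

Lemma zero_hom A B : exists f : hom A B, mx f = sm_zero F (gr B) (gr A).
Proof.
apply/mx_homP; split=> [|X _]; first exact: submonomial_zero.
by rewrite sm_act_zero => Y _; apply/orthogonalC/orth0 => e; rewrite ffunE.
Qed.

Lemma zero_objectP A : is_zero_object A <-> (gr A -> False).
Proof.
split=> [/(_ A)[[f [_ fU]] _] a|A0 B].
  have [z z0] := zero_hom A A.
  have := pone_neq0 (s := F).
  have /ffunP/(_ (a, a)) : mx (idc A) = mx z by rewrite -(fU z I) -(fU (idc A) I).
  by rewrite mx_id z0 !ffunE /= eqxx => ->; rewrite eqxx.
have [z z0] := zero_hom B A; have [z' z0'] := zero_hom A B.
split; [exists z|exists z']; split=> // f _; apply/mx_inj/ffunP => -[b a].
  by case: (A0 b).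
by case: (A0 a).
Qed.

Lemma zero_object_exists : exists A, is_zero_object A.
Proof.
have [A] := mc_inh S; have [R [i [_ i0 _ _]]] := mc_restr (finset.set0 : {set gr A}).
by exists R; apply/zero_objectP => r; have := i0 (i r); rewrite codom_f inE.
Qed.

Lemma mx_zero_object A B D (g : hom B D) (f : hom A B) :
  is_zero_object B -> mx (comp g f) = sm_zero F (gr D) (gr A).
Proof.
move=> /zero_objectP B0; apply/ffunP => -[d a].
by rewrite mx_comp !ffunE /= fsum_zero // => b; case: (B0 b).
Qed.

Lemma is_kernelP M N K (f : hom M N) (k : hom K M) :
  is_kernel f k <-> mx (comp f k) = sm_zero F (gr N) (gr K) /\
    forall T (u : hom T M), mx (comp f u) = sm_zero F (gr N) (gr T) ->
      exists! h, comp k h = u.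
Proof.
split=> [[Z [a [b [Z0 [fk kU]]]]]|[fk kU]].
  split=> [|T u fu]; first by rewrite fk mx_zero_object.
  have [v [_ vU]] := (Z0 T).1.
  have [|h [[kh ah] hU]] := kU T u v.
    by apply/mx_inj; rewrite fu mx_zero_object.
  exists h; split=> // h' kh'; apply: hU; split=> //.
  exact: esym (vU _ I).
have [Z Z0] := zero_object_exists.
have [a [_ aU]] := (Z0 K).1; have [b _] := (Z0 N).2.
exists Z, a, b; split=> //; split=> [|T u v fu].
  by apply/mx_inj; rewrite fk mx_zero_object.
have [|h [kh hU]] := kU T u; first by rewrite fu mx_zero_object.
exists h; split=> [|h' [kh' _]]; last exact: hU.
by split=> //; have [w [_ wU]] := (Z0 T).1; rewrite -(wU v I) -(wU (comp a h) I).
Qed.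

(** These turn out to be the strict monomorphisms (strict_mono_embedding and
   embedding_strict_mono), described by their matrices. *)
Definition embedding A B (f : hom A B) : Prop :=
  (forall a, exists b, mx f (b, a) != pzero) /\
  (forall X, vec (sm_act (mx f) X) -> vec X).

(** The partial inverse of f is a left inverse as a matrix, although it need not
   be a morphism. *)
Lemma nonzero_columns_mono A B (f : hom A B) :
  (forall a, exists b, mx f (b, a) != pzero) -> is_mono f.
Proof.
move=> f0 T u v /(congr1 (@mx F S _ _)); rewrite !mx_comp => fuv; apply: mx_inj.
have fI := sm_inv_mul (mx_submonomial f) f0.
have fiS := submonomial_inv (mx_submonomial f).
by rewrite -(sm_mul1 (mx u)) -(sm_mul1 (mx v)) -fI -!sm_mulA ?fuv //;
   apply: mx_submonomial.
Qed.

(** The factorization is the composite of u with the partial inverse of f; it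
   preserves vectors because f reflects them. *)
Lemma embedding_factor A B T (f : hom A B) (u : hom T B) : embedding f ->
  (forall b t, mx u (b, t) != pzero -> exists a, mx f (b, a) != pzero) ->
  exists h, comp f h = u.
Proof.
move=> [f0 fV] uf; have fS := mx_submonomial f; have uS := mx_submonomial u.
have hS := submonomial_mul (submonomial_inv fS) uS.
have fh := sm_mul_inv fS uf.
have [|h hE] := (mx_homP (sm_mul (sm_inv (mx f)) (mx u))).2.
  split=> // X XT; apply: fV; rewrite -sm_act_mul // fh; exact: mx_vec.
by exists h; apply: mx_inj; rewrite mx_comp hE.
Qed.

Lemma embedding_kernel K M N (k : hom K M) (f : hom M N) : embedding k ->
  (forall m, (exists a, mx k (m, a) != pzero) <-> forall n, mx f (n, m) = pzero) ->
  is_kernel f k.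
Proof.
move=> kE kf; apply/is_kernelP; split=> [|T u fu].
  apply/ffunP => -[n a]; rewrite [RHS]ffunE; apply/eqP/negPn/negP.
  rewrite mx_comp => /sm_mul_neq0[m fm km].
  by have fm0 := (kf m).1 (ex_intro _ a km) n; rewrite fm0 eqxx in fm.
have [m t um|h kh] := embedding_factor (u := u) kE.
  apply/kf => n; apply/eqP/negPn/negP => fm.
  have := sm_mul_neq0I (mx_submonomial f) fm um.
  by rewrite -mx_comp fu ffunE eqxx.
exists h; split=> // h' kh'; apply: (nonzero_columns_mono kE.1).
by rewrite kh kh'.
Qed.

(** Perfection enters here: the extension by 0 of a vector X of the
   restriction is orthogonal to a cocircuit Y because the restriction of Y,
   which in general is not a cocircuit, is a covector. *)
Lemma restriction_embedding A (L : {set gr A}) : exists R (k : hom R A) i,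
  [/\ injective i /\ codom i =i L, mx k = incl_mx F i, embedding k,
      forall X, @mc_cir F S R X -> @mc_cir F S A (sm_act (mx k) X) &
      forall Y, @mc_coc F S R Y ->
        exists2 Y', @mc_coc F S A Y' & Y = sm_act (sm_tr (mx k)) Y'].
Proof.
have [R [i [iI iL cirR cocR]]] := mc_restr L; exists R.
have iS := submonomial_incl F iI.
have [|k kE] := (mx_homP (incl_mx F i)).2.
  split=> // X XR Y YA; apply/orthogonal_act => //; apply: mc_perfect => //.
  move=> X' /cirR X'A; apply/orthogonalC/orthogonal_act => //.
  exact: mc_orth X'A YA.
exists k, i; rewrite kE; split=> // [|Y /cocR[Y' Y'A ->]]; last first.
  by exists Y'; rewrite ?incl_tr_act.
split=> [a|X XA Y /cocR[Y' Y'A ->]].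
  by exists (i a); rewrite kE incl_mx1 pone_neq0.
by rewrite -incl_tr_act //; apply/orthogonal_act => //; rewrite -kE; apply: XA.
Qed.

Lemma incl_image A R (k : hom R A) i (L : {set gr A}) : mx k = incl_mx F i ->
  codom i =i L -> forall a, a \in L <-> exists r, mx k (a, r) != pzero.
Proof.
move=> kE iL a; rewrite -iL; split=> [/codomP[r ->]|[r]].
  by exists r; rewrite kE incl_mx1 pone_neq0.
by rewrite kE => /incl_mxE ->; apply: codom_f.
Qed.

(** The kernel of f is the restriction of M to the zero columns of f. *)
Lemma canonical_kernel M N (f : hom M N) : exists R (k : hom R M),
  [/\ is_kernel f k, embedding k,
      forall X, @mc_cir F S R X -> @mc_cir F S M (sm_act (mx k) X),
      forall Y, @mc_coc F S R Y ->
        exists2 Y', @mc_coc F S M Y' & Y = sm_act (sm_tr (mx k)) Y' &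
      forall m, (exists r, mx k (m, r) != pzero) <-> forall n, mx f (n, m) = pzero].
Proof.
pose L := [set m | [forall n, mx f (n, m) == pzero]]%SET.
have [R [k [i [[iI iL] kE kemb kcir kcoc]]]] := restriction_embedding L.
have kL m : (exists r, mx k (m, r) != pzero) <-> forall n, mx f (n, m) = pzero.
  rewrite -(incl_image kE iL) inE.
  by split=> [/forallP f0 n|f0]; [apply/eqP | apply/forallP => n; apply/eqP].
by exists R, k; split=> //; apply: embedding_kernel.
Qed.

Lemma kernel_exists M N (f : hom M N) : exists K (k : hom K M), is_kernel f k.
Proof. by have [R [k [kf _ _ _ _]]] := canonical_kernel f; exists R, k. Qed.

(** A zero column of f would be an element of the canonical kernel. *)
Lemma mono_of_zero_kernel M N K (f : hom M N) (k : hom K M) :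
  is_kernel f k -> is_zero_object K -> is_mono f.
Proof.
move=> /is_kernelP[_ kU] K0; apply: nonzero_columns_mono => m.
have [R [k0 [/is_kernelP[fk0 _] _ _ _ k0f]]] := canonical_kernel f.
have [h [kh _]] := kU _ _ fk0.
have [//|fm] := pselect (exists n, mx f (n, m) != pzero).
have [|r] := (k0f m).2; first by move=> n; apply/eqP/negPn/negP => fn; apply: fm; exists n.
by rewrite -kh mx_zero_object // ffunE eqxx.
Qed.

(** Kernels of the same morphism are isomorphic, and one of them is a
   restriction. *)
Lemma strict_mono_restriction A D (f : hom A D) : strict_mono f ->
  exists R (k : hom R D) (u : hom A R) (v : hom R A),
  [/\ comp k u = f /\ comp f v = k, comp v u = idc A /\ comp u v = idc R,
      embedding k,
      forall X, @mc_cir F S R X -> @mc_cir F S D (sm_act (mx k) X) &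
      forall Y, @mc_coc F S R Y ->
        exists2 Y', @mc_coc F S D Y' & Y = sm_act (sm_tr (mx k)) Y'].
Proof.
move=> [N [f' /is_kernelP[f'f fU]]].
have [R [k [/is_kernelP[f'k kU] kE kcir kcoc _]]] := canonical_kernel f'.
have [u [ku _]] := kU _ _ f'f; have [v [fv _]] := fU _ _ f'k.
exists R, k, u, v; split=> //; split.
  have [w [_ wU]] := fU _ _ f'f.
  by rewrite -(wU (idc A)) ?compf1 // -(wU (comp v u)) // compA fv.
by apply: (nonzero_columns_mono kE.1); rewrite compA ku fv compf1.
Qed.

Lemma strict_mono_embedding A D (f : hom A D) : strict_mono f -> embedding f.
Proof.
move=> /strict_mono_restriction[R [k [u [v [[<- _] [vu _] [k0 kV] _ _]]]]].
split=> [a|X].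
  have : mx (idc A) (a, a) != pzero by rewrite mx_id ffunE eqxx pone_neq0.
  rewrite -vu mx_comp => /sm_mul_neq0[r _ ur]; have [d kd] := k0 r.
  by exists d; rewrite mx_comp; apply: sm_mul_neq0I ur => //; apply: mx_submonomial.
rewrite mx_act_comp => /kV uX.
by rewrite -(sm_act1 X) -mx_id -vu mx_act_comp; apply: mx_vec.
Qed.

Lemma strict_mono_iso A D Q (f : hom A D) (g : hom D Q) (g' : hom Q D) :
  comp g' g = idc D -> comp g g' = idc Q -> strict_mono f -> strict_mono (comp g f).
Proof.
move=> g'g gg' [N [f' /is_kernelP[f'f fU]]]; exists N, (comp f' g').
have can T (w : hom T D) : comp g' (comp g w) = w by rewrite compA g'g comp1f.
apply/is_kernelP; split=> [|T w f'w]; first by rewrite -compA can.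
have [|h [fh hU]] := fU T (comp g' w); first by rewrite compA.
exists h; split=> [|h' fh']; first by rewrite -compA fh compA gg' comp1f.
by apply: hU; rewrite -fh' -compA can.
Qed.

(** Circuits need not correspond under isomorphisms; but as those of a
   restriction are circuits of the ambient object, it is enough to test a
   covector of a strict subobject on vectors that become circuits. *)
Lemma covect_strict_mono A D (f : hom A D) Z : strict_mono f ->
  (forall X, @mc_cir F S D (sm_act (mx f) X) -> orthogonal Z X) -> covect Z.
Proof.
move=> /strict_mono_restriction[R [k [u [v [[ku fv] [vu _] _ kcir _]]]]] ZX.
suff ZR : covect (sm_act (sm_tr (mx v)) Z).
  have := mx_covect u ZR; rewrite -sm_act_mul; last 2 first.
  - exact/submonomial_tr/mx_submonomial.
  - exact/submonomial_tr/mx_submonomial.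
  by rewrite -sm_tr_mul -mx_comp vu mx_id sm_tr_one sm_act1.
move=> X XR; apply/orthogonalC/orthogonal_act; first exact: mx_submonomial.
by apply/orthogonalC/ZX; rewrite -mx_act_comp fv; apply: kcir.
Qed.

End MatrixCategory.

(** * Duality *)

Section Opposite.

Definition op_cat (C : category) : category :=
  @Category C (fun A B => @hom C B A) (@idc C)
    (fun A B D g f => comp f g)
    (fun A B D E h g f => esym (compA f g h))
    (fun A B f => compf1 f) (fun A B f => comp1f f).

Variables (F : idyllType) (S : matcat F).

Fact op_mx_inj (A B : op_cat S) (f g : @hom (op_cat S) A B) :
  sm_tr (mx f) = sm_tr (mx g) -> f = g.
Proof. by move=> fg; apply: mx_inj; rewrite -(sm_trK (mx f)) fg sm_trK. Qed.

Fact op_mx_id (A : op_cat S) : sm_tr (mx (@idc (op_cat S) A)) = sm_one F (gr A).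
Proof. by rewrite mx_id sm_tr_one. Qed.

Fact op_mx_comp (A B D : op_cat S) (g : @hom (op_cat S) B D)
    (f : @hom (op_cat S) A B) :
  sm_tr (mx (comp g f)) = sm_mul (sm_tr (mx g)) (sm_tr (mx f)).
Proof. by rewrite mx_comp sm_tr_mul. Qed.

Fact op_mx_homP (A B : op_cat S) (f : {ffun gr (m := S) B * gr (m := S) A -> F}) :
  (exists h : @hom (op_cat S) A B, sm_tr (mx h) = f) <->
  submonomial f /\ (forall X, orth_compl (@mc_cir F S A) X ->
                              orth_compl (@mc_cir F S B) (sm_act f X)).
Proof.
split=> [[h <-]|[fS fW]].
  split=> [|X]; first exact/submonomial_tr/mx_submonomial.
  exact: mx_covect.
have [|h hE] := (mx_homP (sm_tr f)).2; last by exists h; rewrite hE sm_trK.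
split=> [|X XB]; first exact: submonomial_tr.
apply/vecP => Z ZA; apply/orthogonal_act; first exact: submonomial_tr.
by rewrite sm_trK; apply: mc_perfect => //; apply: fW.
Qed.

Fact op_orth A X Y : @mc_coc F S A X -> @mc_cir F S A Y -> orthogonal X Y.
Proof. by move=> XA YA; apply/orthogonalC/(mc_orth YA XA). Qed.

Fact op_perfect A X Z : orth_compl (@mc_cir F S A) X ->
  orth_compl (@mc_coc F S A) Z -> orthogonal X Z.
Proof. by move=> XA ZA; apply/orthogonalC/(mc_perfect ZA XA). Qed.

Definition op : matcat F :=
  @MatCat F (op_cat S) (@gr F S) (@mc_coc F S) (@mc_cir F S)
    (fun A B f => sm_tr (mx f)) op_mx_inj op_mx_id op_mx_comp op_mx_homP
    op_orth op_perfect (mc_inh S) (@mc_contr F S) (@mc_restr F S).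

End Opposite.

(** * Proto-abelian matrix categories *)

Lemma op_zero_object (C : category) (Z : C) :
  @is_zero_object (op_cat C) Z <-> is_zero_object Z.
Proof. by split=> Z0 A; have [] := Z0 A. Qed.

Lemma op_is_kernel (C : category) (M N Q : C) (f : hom M N) (c : hom N Q) :
  @is_kernel (op_cat C) N M Q f c <-> is_cokernel f c.
Proof.
by split=> -[Z [a [b [Z0 ab]]]]; exists Z, b, a; split=> //; apply/op_zero_object.
Qed.

Lemma op_strict_mono (C : category) (N Q : C) (c : hom N Q) :
  @strict_mono (op_cat C) Q N c <-> strict_epi c.
Proof. by split=> -[M [f fc]]; exists M, f; apply/op_is_kernel. Qed.

Section ProtoAbelian.
Variables (F : idyllType).

(** The embedding is the kernel of the contraction of its image. *)
Lemma embedding_strict_mono (S : matcat F) (K M : S) (k : hom K M) :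
  embedding k -> strict_mono k.
Proof.
move=> kE.
(* in the opposite category, the restriction to L is the contraction onto L *)
pose L := [set m | [forall a, mx k (m, a) == pzero]]%SET.
have [Q [c [i [[iI iL] cE _ _ _]]]] := @restriction_embedding _ (op S) M L.
exists Q, c; apply: embedding_kernel => // m.
have mL := incl_image (S := op S) cE iL m; split=> [[a ka] n|cm].
  apply/eqP/negPn/negP => cn; have : m \in L by apply/mL; exists n; rewrite sm_trE.
  by rewrite inE => /forallP/(_ a); rewrite (negbTE ka).
have [//|km] := pselect (exists a, mx k (m, a) != pzero).
have /mL[n] : m \in L.
  by rewrite inE; apply/forallP => a; apply/negPn/negP => ka; apply: km; exists a.
by rewrite sm_trE (cm n) eqxx.
Qed.

(** The dual of strict_mono_restriction: cocircuits of a restriction lift, hence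
   so do circuits of a contraction. *)
Lemma strict_epi_contraction (S : matcat F) (B D : S) (g : hom B D) :
  strict_epi g -> exists Q (c : hom B Q) (u : hom Q D) (v : hom D Q),
    [/\ comp u c = g, comp u v = idc D, comp v u = idc Q &
        forall X, @mc_cir F S Q X -> exists2 W, @mc_cir F S B W & X = sm_act (mx c) W].
Proof.
move=> /op_strict_mono gM.
have [Q [c [u [v [[uc _] [uv vu] _ _ clift]]]]] :=
  @strict_mono_restriction _ (op S) _ _ _ gM.
exists Q, c, u, v; split=> // X /clift[W WB ->].
by exists W; rewrite //= sm_trK.
Qed.

(** Up to isomorphism g is a contraction, and the pullback is the restriction
   of B to the elements whose image under g is 0 or lies in A.  A covector of
   that restriction which comes from a vector Z on A is orthogonal to the
   vectors of A that become circuits of the contraction, because those lift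
   to circuits of B; these suffice to make Z a covector. *)
Lemma pullback_strict_epi (S : matcat F) (P A B D : S)
    (p : hom P A) (q : hom P B) (f : hom A D) (g : hom B D) :
  is_pullback p q f g -> strict_mono f -> strict_epi g -> strict_epi p.
Proof.
move=> [_ pU] fM gE; have [f0 fV] := strict_mono_embedding fM.
have [g0 _] := @strict_mono_embedding _ (op S) _ _ _ ((op_strict_mono g).2 gE).
have [Q [c [u [v [uc uv vu clift]]]]] := strict_epi_contraction gE.
have fS := mx_submonomial f; have gS := mx_submonomial g.
pose L := [set b | [forall d, (mx g (d, b) != pzero) ==>
                              [exists a, mx f (d, a) != pzero]]]%SET.
have LP b : b \in L <-> forall d, mx g (d, b) != pzero -> exists a, mx f (d, a) != pzero.
  rewrite inE; split=> [/forallP gb d gdb|gb].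
    by have /implyP/(_ gdb)/existsP := gb d.
  by apply/forallP => d; apply/implyP => gdb; apply/existsP/gb.
have [P0 [q0 [i [[iI iL] q0E q0emb _ _]]]] := restriction_embedding L.
have Li := incl_image q0E iL.
have [|p0 p0E] := @embedding_factor _ S _ _ _ f (comp g q0) (conj f0 fV).
  move=> d x; rewrite mx_comp => /sm_mul_neq0[b gdb q0b].
  by have /Li/LP/(_ d gdb) : exists r, mx q0 (b, r) != pzero by exists x.
have [h [[ph qh] _]] := pU _ _ _ p0E.
apply/op_strict_mono/(@embedding_strict_mono (op S)).
split=> [a|Z ZP].
  have [d fda] := f0 a; have [b] := g0 d; rewrite sm_trE => gdb.
  have /Li[x q0b] : b \in L.
    by apply/LP => d' gd'b; rewrite (gS.2 _ _ _ gd'b gdb); exists a.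
  have := sm_mul_neq0I gS gdb q0b; rewrite -mx_comp -p0E mx_comp.
  move=> /sm_mul_neq0[a' fda']; rewrite -(fS.1 _ _ _ fda fda') -ph mx_comp.
  by move=> /sm_mul_neq0[y pay _]; exists y; rewrite sm_trE.
have {}ZP : covect (sm_act (sm_tr (mx p0)) Z).
  rewrite -ph mx_comp sm_tr_mul sm_act_mul; last 2 first.
  - exact/submonomial_tr/mx_submonomial.
  - exact/submonomial_tr/mx_submonomial.
  exact: mx_covect.
have vfM := strict_mono_iso uv vu fM.
apply: (covect_strict_mono vfM) => X /clift[W WB].
rewrite mx_act_comp => XW.
have gWE : sm_act (mx g) W = sm_act (mx f) X.
  rewrite -uc mx_act_comp -XW -mx_act_comp uv mx_id.
  exact: sm_act1.
have WL b : W b != pzero -> exists x, b = i x.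
  move=> Wb; apply/codomP; rewrite iL; apply/LP => d gdb.
  have : sm_act (mx g) W d != pzero by rewrite (sm_act_single _ gS gdb) pmul_neq0.
  rewrite gWE ffunE => /fsum_neq0[a /pmul_neq0P[fda _]]; by exists a.
pose W' : {ffun gr P0 -> F} := [ffun x => W (i x)].
have WE : sm_act (mx q0) W' = W by rewrite q0E incl_act_tr.
(* p0 W' and X have the same image under f, which is left invertible *)
have <- : sm_act (mx p0) W' = X.
  have fI := sm_inv_mul fS f0; have fiS := submonomial_inv fS.
  rewrite -[LHS]sm_act1 -[RHS]sm_act1 -fI !sm_act_mul //.
  by rewrite -mx_act_comp p0E mx_act_comp WE gWE.
apply/orthogonalC/orthogonal_act; first exact: mx_submonomial.
by apply: mc_perfect ZP; apply: q0emb.2; rewrite WE; apply: cir_vec.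
Qed.

Theorem matcat_proto_abelian (S : matcat F) : proto_abelian S.
Proof.
split.
- exact: zero_object_exists.
- exact: kernel_exists.
- move=> M N f; have [Q [c fc]] := @kernel_exists _ (op S) N M f.
  by exists Q, c; apply/op_is_kernel.
- split; first exact: mono_of_zero_kernel.
  move=> M N Q f c /op_is_kernel fc /op_zero_object Q0.
  exact: (@mono_of_zero_kernel _ (op S) _ _ _ f c fc Q0).
split; first exact: pullback_strict_epi.
move=> D A B P f g p q fgpq gM fE.
apply/(op_strict_mono (C := op_cat S)).
apply: (@pullback_strict_epi (op S) P A B D p q f g fgpq).
  exact/op_strict_mono.
exact/(op_strict_mono (C := op_cat S)).
Qed.

End ProtoAbelian.

(** * The category of pointed matroids *)

Section PointedMatroids.
Variables (F : idyllType) (hF : perfect F).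

Fact FMat_homP (M N : pointedMatroid F) (f : {ffun tground N * tground M -> F}) :
  (exists h : matMor M N, mor_mx h = f) <->
  submonomial f /\ (forall X, orth_compl (@coc F M) X ->
                              orth_compl (@coc F N) (sm_act f X)).
Proof.
rewrite -!pvectorsE; split=> [[h <-]|fM]; first exact: mor_mxP.
by exists (MatMor fM).
Qed.

Definition FMat_matcat : matcat F :=
  @MatCat F (FMat F) (@tground F) (@cir F) (@coc F) (@mor_mx F) (@matMor_inj F)
    (fun=> erefl) (fun _ _ _ _ _ => erefl) FMat_homP (@cir_coc_orth F)
    (fun M X Z => @perfect_orth F M X Z hF) (inhabited_matroid F)
    (@restriction_exists F) (@contraction_exists F).

End PointedMatroids.

Theorem corollary3p12 (F : idyllType) (hF : perfect F) : proto_abelian (FMat F).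
Proof. exact: (matcat_proto_abelian (FMat_matcat hF)). Qed.
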